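(* Let $G$ be a $\sigma$-compact, locally compact group acting sharply $3$-transitively and continuously on an infinite disconnected compact space $M$. Then $G$ is hyperbolic and $M$ is $G$-equivariantly homeomorphic to the boundary $\partial G$ of $G$.
   Context: Compact and locally compact spaces and groups are Hausdorff. $G$ acts continuously on $M$ if the action map $G\times M\to M$ is continuous. $G$ acts sharply $3$-transitively on $M$ if the diagonal action on the set of triples of pairwise distinct points of $M$ is free and transitive. A locally compact group $G$ is hyperbolic if it is compactly generated and Gromov hyperbolic for the word metric associated to some (equivalently any) compact generating subset; equivalently, $G$ acts continuously, properly, cocompactly and by isometries on a proper geodesic Gromov hyperbolic metric space $X$. Such $X$ is unique up to quasi-isometry, and $\partial G$ denotes the Gromov boundary $\partial X$ with its $G$-action. *)

(* Defs.v *)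
From HB Require Import structures.
From mathcomp Require Import all_boot all_order all_algebra.
From mathcomp Require Import all_classical all_reals all_analysis.

Set Implicit Arguments.
Unset Strict Implicit.
Unset Printing Implicit Defensive.

Import Order.TTheory GRing.Theory Num.Theory.
Import numFieldNormedType.Exports.

Local Open Scope classical_set_scope.
Local Open Scope ring_scope.

HB.mixin Record isTopologicalGroup G of Group G & Topological G := {
  mulg_continuous : continuous (fun gh : G * G => (gh.1 * gh.2)%g) ;
  invg_continuous : continuous (fun g : G => g^-1%g)
}.

#[short(type="topologicalGroupType")]
HB.structure Definition TopologicalGroup :=
  {G of isTopologicalGroup G & Group G & Topological G}.

Definition sigma_compact (T : topologicalType) : Prop :=
  exists2 K : nat -> set T, (forall n, compact (K n)) & \bigcup_n K n = setT.

Section Actions.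
Variables (G : topologicalGroupType).

Definition group_action (T : Type) (a : G -> T -> T) : Prop :=
  (forall x, a 1%g x = x) /\ (forall g h x, a (g * h)%g x = a g (a h x)).

Definition continuous_action (T : topologicalType) (a : G -> T -> T) : Prop :=
  group_action a /\ continuous (fun gx : G * T => a gx.1 gx.2).

Definition pairwise_distinct (T : Type) (x : T * T * T) : Prop :=
  [/\ x.1.1 <> x.1.2, x.1.1 <> x.2 & x.1.2 <> x.2].

Definition diag3 (T : Type) (a : G -> T -> T) (g : G) (x : T * T * T) :=
  (a g x.1.1, a g x.1.2, a g x.2).

Definition sharply_3_transitive (T : Type) (a : G -> T -> T) : Prop :=
  (forall x, pairwise_distinct x -> forall g, diag3 a g x = x -> g = 1%g) /\
  (forall x y, pairwise_distinct x -> pairwise_distinct y ->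
     exists g, diag3 a g x = y).

Definition proper_action (T : topologicalType) (a : G -> T -> T) : Prop :=
  forall K : set T, compact K -> compact [set g | (a g @` K) `&` K !=set0].

Definition cocompact_action (T : topologicalType) (a : G -> T -> T) : Prop :=
  exists2 K : set T, compact K & \bigcup_(g in [set: G]) (a g @` K) = setT.

End Actions.

Section GromovHyperbolicity.
Variables (R : realType) (T : Type) (d : T -> T -> R).

Definition gromov_product (o x y : T) : R := (d o x + d o y - d x y) / 2.

Definition gromov_hyperbolic : Prop :=
  exists2 delta : R, 0 <= delta &
    forall o x y z : T,
      Num.min (gromov_product o x y) (gromov_product o y z) - delta
        <= gromov_product o x z.

End GromovHyperbolicity.

Section WordMetric.
Variables (R : realType) (G : groupType).

(* products of exactly n elements of S `|` S^-1 *)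
Fixpoint word_products (S : set G) (n : nat) : set G :=
  if n is n'.+1 then
    [set (g * s)%g | g in word_products S n' & s in S `|` [set t^-1%g | t in S]]
  else [set 1%g].

Definition generates (S : set G) : Prop := \bigcup_n word_products S n = setT.

(* Only meaningful when S generates G (otherwise inf may be that of an empty
   set); then the infimum is the least length of a word representing g. *)
Definition word_length (S : set G) (g : G) : R :=
  inf [set n%:R | n in [set n | word_products S n g]].

Definition word_metric (S : set G) (g h : G) : R :=
  word_length S (g^-1 * h)%g.

End WordMetric.

Definition hyperbolic_group (R : realType) (G : topologicalGroupType) : Prop :=
  exists S : set G, [/\ compact S, generates S
                      & gromov_hyperbolic (word_metric R S)].

Section MetricSpaces.
Variables (R : realType) (X : metricType R).

Definition proper_metric : Prop :=
  forall (x : X) (r : R), compact [set y | mdist x y <= r].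

Definition geodesic_metric : Prop :=
  forall x y : X, exists c : R -> X,
    [/\ c 0 = x, c (mdist x y) = y
      & forall s t, 0 <= s <= mdist x y -> 0 <= t <= mdist x y ->
          mdist (c s) (c t) = `|s - t|].

(* (x_i | y_j)_o --> +oo as i and j tend to infinity; when X is Gromov
   hyperbolic, the condition does not depend on the base point o. *)
Definition gromov_converge (x y : nat -> X) : Prop :=
  forall o : X,
    gromov_product mdist o (x ij.1) (y ij.2) @[ij --> (\oo, \oo)] --> +oo.

Definition gromov_sequence (x : nat -> X) : Prop := gromov_converge x x.

Definition gromov_class (x : nat -> X) : set (nat -> X) :=
  [set y | gromov_sequence y /\ gromov_converge x y].

(* Points of the boundary are the equivalence classes of sequences converging
   to infinity. *)
Record gromov_boundary := GromovBoundary {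
  boundary_class :> set (nat -> X) ;
  boundary_classP :
    exists2 x, gromov_sequence x & boundary_class = gromov_class x
}.

HB.instance Definition _ := gen_eqMixin gromov_boundary.
HB.instance Definition _ := gen_choiceMixin gromov_boundary.

(* The sets U(p, r), r in R, form a neighbourhood basis of p (they need not be
   open themselves), whichever base point o is used. *)
Definition boundary_nbhd (o : X) (p : gromov_boundary) (r : R) :
    set gromov_boundary :=
  [set q | exists x y : nat -> X, [/\ boundary_class p x, boundary_class q y
     & \forall i \near \oo & j \near \oo,
         r <= gromov_product mdist o (x i) (y j)]].

Definition boundary_open (O : set gromov_boundary) : Prop :=
  forall p, O p -> forall o, exists r, boundary_nbhd o p r `<=` O.

Lemma boundary_openT : boundary_open setT.
Proof. by move=> p _ o; exists 0. Qed.

Lemma boundary_openI : setI_closed boundary_open.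
Proof.
move=> A B oA oB p [Ap Bp] o.
have [r rA] := oA p Ap o; have [s sB] := oB p Bp o.
exists (Num.max r s) => q [x [y [px qy xy]]]; split.
- apply: rA; exists x, y; split=> //; apply: filterS xy => ij.
  by rewrite ge_max => /andP[].
- apply: sB; exists x, y; split=> //; apply: filterS xy => ij.
  by rewrite ge_max => /andP[].
Qed.

Lemma boundary_open_bigcup (I : Type) (f : I -> set gromov_boundary) :
  (forall i, boundary_open (f i)) -> boundary_open (\bigcup_i f i).
Proof.
move=> of_ p [i _ fip] o; have [r rf] := of_ i p fip o.
by exists r => q /rf fiq; exists i.
Qed.

HB.instance Definition _ := isOpenTopological.Build gromov_boundary
  boundary_openT boundary_openI boundary_open_bigcup.

End MetricSpaces.

Arguments proper_metric {R} X.
Arguments geodesic_metric {R} X.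
Arguments gromov_boundary {R} X.

(* A geometric action on a proper geodesic Gromov hyperbolic space. Nonemptiness
   of X excludes the (otherwise proper and cocompact) action of an arbitrary
   group on the empty space. *)
Definition hyperbolic_model (R : realType) (G : topologicalGroupType)
    (X : metricType R) (a : G -> X -> X) : Prop :=
  [/\ [set: X] !=set0,
      [/\ proper_metric X, geodesic_metric X & gromov_hyperbolic (@mdist R X)],
      continuous_action a,
      forall g x y, mdist (a g x) (a g y) = mdist x y
    & proper_action a /\ cocompact_action a].

(* The action of G on the boundary is g.[x_n] = [g x_n]; as a set of sequences,
   g.p is the image of p under x |-> a g \o x. *)
Definition equivariantly_homeomorphic_to_boundary (R : realType)
    (G : topologicalGroupType) (M : topologicalType) (aM : G -> M -> M)
    (X : metricType R) (aX : G -> X -> X) : Prop :=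
  exists (f : M -> gromov_boundary X) (f' : gromov_boundary X -> M),
    [/\ cancel f f', cancel f' f, continuous f, continuous f'
      & forall g m, boundary_class (f (aM g m)) =
                    [set (aX g \o x) | x in boundary_class (f m)]].

(* M is G-equivariantly homeomorphic to the boundary of G, which is the boundary
   of any space X as above: such X exist, and all of them give M. *)
Definition equivariantly_homeomorphic_to_group_boundary (R : realType)
    (G : topologicalGroupType) (M : topologicalType) (aM : G -> M -> M) : Prop :=
  (exists (X : metricType R) (aX : G -> X -> X), hyperbolic_model aX) /\
  (forall (X : metricType R) (aX : G -> X -> X), hyperbolic_model aX ->
     equivariantly_homeomorphic_to_boundary aM aX).

(* Main.v *)
(** Since M is disconnected and G is 2-transitive, M is totally disconnected.
By Baire's theorem G is homeomorphic to the space of triples of distinct points,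
so it acts properly and cocompactly (even transitively) on triples. Fix a base
triple t and a clopen set U. Every g in G is on the U-side or on the other side,
according to where the majority of g.t lies, and properness gives:
- for S compact, the g such that g and gs are on different sides for some s in S
  form a relatively compact set, so that a path in G (or in a space X on which G
  acts geometrically) from one side to the other meets a fixed ball;
- every point of M has arbitrarily small neighbourhoods of the form k^-1.U, with
  k arbitrarily far away and on the side opposite to U.
Let a geodesic through the base point o have endpoints x and z which are joined
by a path avoiding a large ball around o. Then x and z both lie in some k^-1.U as
above, so the translate by k of the geodesic goes from the U-side to k.o, which is
far away on the other side, and back to the U-side. It thus meets a fixed ball
both before and after k.o, which is impossible for a geodesic. Hence geodesic
triangles are thin, for every geometric action of G. The same two properties
show that Gromov products of orbit points tend to infinity exactly when the
points tend to the same point of M, which identifies M with the boundary.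
Compact generation comes from expansion: U is covered by finitely many translates
strictly contained in it, and iterating the inverse maps moves any triple into a
compact set. A model space is the Cayley graph of G relative to the stabilizer of
U, which is a compact open subgroup. *)

From HB Require Import structures.
Require Import Defs.
From mathcomp Require Import all_boot all_order all_algebra.
From mathcomp Require Import all_classical all_reals all_analysis.
From mathcomp Require Import zify lra.

Set Implicit Arguments.
Unset Strict Implicit.
Unset Printing Implicit Defensive.

Import Order.TTheory GRing.Theory Num.Theory.
Import numFieldNormedType.Exports.

Local Open Scope classical_set_scope.

(** * Compactness and clopen sets *)

(** Containment in a compact set passes at once to subsets, finite unions, products and inverses,
    with no closures to compute. *)
Definition relatively_compact (T : topologicalType) (A : set T) :=
  exists2 K, compact K & A `<=` K.

Section RelativelyCompact.
Variable T : topologicalType.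
Implicit Types A B : set T.

Lemma sub_relatively_compact A B :
  A `<=` B -> relatively_compact B -> relatively_compact A.
Proof. by move=> AB [K cK BK]; exists K => //; exact: subset_trans BK. Qed.

Lemma relatively_compactU A B : relatively_compact A -> relatively_compact B ->
  relatively_compact (A `|` B).
Proof.
by move=> [K cK AK] [L cL BL]; exists (K `|` L); [exact: compactU|exact: setUSS].
Qed.

Lemma relatively_compact0 : relatively_compact (set0 : set T).
Proof. by exists set0; [exact: compact0|]. Qed.

Lemma relatively_compact_seq (I : eqType) (s : seq I) (F : I -> set T) :
  (forall i, i \in s -> relatively_compact (F i)) ->
  relatively_compact [set x | exists2 i, i \in s & F i x].
Proof.
elim: s => [|i s IH] sF.
  by apply: sub_relatively_compact relatively_compact0 => x [].
have FU : [set x | exists2 j, j \in i :: s & F j x] `<=`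
    F i `|` [set x | exists2 j, j \in s & F j x].
  move=> x [j]; rewrite in_cons => /predU1P[->|js] Fjx; first by left.
  by right; exists j.
apply: sub_relatively_compact FU _; apply: relatively_compactU.
  by apply: sF; rewrite mem_head.
by apply: IH => j js; apply: sF; rewrite in_cons js orbT.
Qed.

(** The near-covering form of compactness is applied to the filter of finite lists of points of [K],
    ordered by inclusion. *)
Lemma compact_finite_cover (K : set T) (U : T -> set T) : compact K ->
  (forall x, K x -> nbhs x (U x)) ->
  exists s : seq T, (forall x, x \in s -> K x) /\
    forall y, K y -> exists2 x, x \in s & U x y.
Proof.
move=> cK nU; pose D := [set s : seq T | forall x, x \in s -> K x].
pose F := filter_from D (fun s => [set s' | D s' /\ {subset s <= s'}]).
have FF : Filter F.
  apply: filter_from_filter; first by exists [::].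
  move=> s s' Ds Ds'; exists (s ++ s').
    by move=> x; rewrite mem_cat => /orP[/Ds|/Ds'].
  move=> t [Dt st]; split; split=> // x xs; apply: st;
    by rewrite mem_cat xs ?orbT.
have [] := (compact_near_coveringP K).1 cK _ F
  (fun s x => exists2 y, y \in s & U y x) FF.
  move=> x Kx; exists (U x, [set s | D s /\ {subset [:: x] <= s}]).
    split; first exact: nU.
    by exists [:: x] => // y; rewrite inE => /eqP ->.
  by move=> [y s] /= [Uxy [_ xs]]; exists x => //; apply: xs; rewrite mem_head.
move=> s Ds sK; exists s; split=> // y Ky.
by exact: (sK s (conj Ds (fun _ => id)) y Ky).
Qed.

End RelativelyCompact.

Lemma relatively_compact_near (T S : topologicalType) (K : set T)
    (P : T -> set S) : compact K ->
  (forall x, K x -> exists2 N, nbhs x N &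
     relatively_compact [set y | exists2 x', N x' & P x' y]) ->
  relatively_compact [set y | exists2 x, K x & P x y].
Proof.
move=> cK nP.
have /choice[N NP] : forall x, exists N, K x -> nbhs x N /\
    relatively_compact [set y | exists2 x', N x' & P x' y].
  move=> x; have [Kx|nKx] := pselect (K x); last by exists setT.
  by have [N nN NP] := nP x Kx; exists N.
have [|s [sK sN]] := @compact_finite_cover _ K N cK.
  by move=> x /NP[].
apply: (@sub_relatively_compact _ _
  [set y | exists2 x, x \in s & exists2 x', N x x' & P x' y]).
  by move=> y [x /sN[x' x's Nx] Pxy]; exists x' => //; exists x.
apply: relatively_compact_seq => x /sK/NP[]//.
Qed.


Lemma zero_dimensional_hausdorff (T : topologicalType) :
  zero_dimensional T -> hausdorff_space T.
Proof.
move=> zT; rewrite open_hausdorff => x y /zT[U [[oU cU] Ux nUy]].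
exists (U, ~` U); first by split; rewrite inE.
by split=> //=; [exact: closed_openC|rewrite setICr].
Qed.

Lemma clopen_nbhs (T : topologicalType) (x : T) (N : set T) :
  zero_dimensional T -> compact [set: T] -> nbhs x N ->
  exists2 U, clopen U & U x /\ U `<=` N.
Proof.
move=> zT cT nN; have hT := zero_dimensional_hausdorff zT.
by have [U [Ux cU] UN] := zero_dimensional_cvg (x := x) hT zT cT nN; exists U.
Qed.

Lemma continuous_pair (S T U : topologicalType) (f : S -> T) (g : S -> U) :
  continuous f -> continuous g -> continuous (fun x => (f x, g x)).
Proof. by move=> cf cg x; apply: cvg_pair; [exact: cf|exact: cg]. Qed.

Lemma continuous_compose (S T U : topologicalType) (g : T -> U) (f : S -> T) :
  continuous g -> continuous f -> continuous (fun x => g (f x)).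
Proof.
by move=> cg cf x; apply: (@continuous_comp _ _ _ f g); [exact: cf|exact: cg].
Qed.

Lemma continuous_op2 (S T U V : topologicalType) (op : T -> U -> V)
    (f : S -> T) (g : S -> U) :
  continuous (fun p : T * U => op p.1 p.2) -> continuous f -> continuous g ->
  continuous (fun x => op (f x) (g x)).
Proof.
move=> cop cf cg.
exact: (continuous_compose (f := fun x => (f x, g x)) cop (continuous_pair cf cg)).
Qed.

Lemma continuous_cst (S T : topologicalType) (y : T) :
  continuous (fun _ : S => y).
Proof. by move=> x; exact: cvg_cst. Qed.

Lemma continuous_idfun (T : topologicalType) : continuous (fun x : T => x).
Proof. by move=> x; exact: cvg_id. Qed.

Lemma fst_continuous (S T : topologicalType) : continuous (@fst S T).
Proof. by move=> x; exact: cvg_fst. Qed.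

Lemma snd_continuous (S T : topologicalType) : continuous (@snd S T).
Proof. by move=> x; exact: cvg_snd. Qed.

Lemma zero_dimensional_pair (S T : topologicalType) :
  zero_dimensional S -> zero_dimensional T -> zero_dimensional (S * T)%type.
Proof.
move=> zS zT [x y] [x' y']; rewrite xpair_eqE negb_and.
move=> /orP[/zS|/zT] [U [cU Ux nUx']].
- exists (fst @^-1` U); split=> //.
  exact: preimage_clopen cU (@fst_continuous S T).
- exists (snd @^-1` U); split=> //.
  exact: preimage_clopen cU (@snd_continuous S T).
Qed.

(** Baire's theorem: if every [C n] had empty interior, one could choose nested nonempty clopen sets
    in [O] avoiding the [C n] one after the other; by compactness they share a point of [O], which
    no [C n] contains. *)
Lemma compact_baire (T : topologicalType) (C : nat -> set T) (O : set T) :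
  zero_dimensional T -> compact [set: T] -> (forall n, closed (C n)) ->
  open O -> O !=set0 -> O `<=` \bigcup_n C n -> exists n, interior (C n) !=set0.
Proof.
move=> zT cT cC oO [x0 Ox0] OC; apply: contrapT => nC.
(* The choice function is total: the empty set is a dummy value when the given set is not open or is
   empty. *)
have /choice[F FP] : forall p : nat * set T, exists W, open p.2 -> p.2 !=set0 ->
    [/\ clopen W, W !=set0, W `<=` p.2 & W `<=` ~` C p.1].
  move=> [n V] /=; have [[oV [x Vx]]|] := pselect (open V /\ V !=set0); last first.
    by move=> nV; exists set0 => oV V0; exfalso; apply: nV.
  have [y [Vy nCy]] : exists y, V y /\ ~ C n y.
    apply: contrapT => VC; apply: nC; exists n, x; rewrite /interior nbhsE.
    exists V => // y Vy; apply: contrapT => nCy; apply: VC.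
    by exists y.
  have /(clopen_nbhs zT cT)[W cW [Wy WV]] : nbhs y (V `&` ~` C n).
    by apply: open_nbhs_nbhs; split=> //; apply: openI => //; exact: closed_openC.
  exists W => _ _; split=> //; first by exists y.
    by move=> z /WV[].
  by move=> z /WV[].
have [W0 [oW0 cW0] [W0x W0O]] := clopen_nbhs zT cT (open_nbhs_nbhs (conj oO Ox0)).
pose W := fix W n := if n is n'.+1 then F (n', W n') else W0.
have WP n : clopen (W n) /\ W n !=set0.
  elim: n => [|n [[oW cW] W0']]; first by split=> //; exists x0.
  by have [] := FP (n, W n) oW W0'.
have WS n : W n.+1 `<=` W n.
  by have [[oW _] W1] := WP n; have [] := FP (n, W n) oW W1.
have WC n : W n.+1 `<=` ~` C n.
  by have [[oW _] W1] := WP n; have [] := FP (n, W n) oW W1.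
have Wmon m n : (m <= n)%N -> W n `<=` W m.
  move=> /subnK <-; elim: (n - m)%N => // k IH; rewrite addSn.
  exact: subset_trans (WS _) IH.
pose FW := filter_from [set: nat] W.
have PF : ProperFilter FW.
  apply: filter_from_proper; last by move=> n _; have [] := WP n.
  apply: filter_from_filter; first by exists 0%N.
  move=> m n _ _; exists (maxn m n) => // x Wx; split.
    by apply: Wmon Wx; exact: leq_maxl.
  by apply: Wmon Wx; exact: leq_maxr.
have [|p [_ clp]] := cT FW PF; first by exists 0%N.
have Wp n : W n p.
  have [[_ cW] _] := WP n; apply: cW => B nB.
  by apply: clp nB; exists n.
have [n _ Cnp] := OC p (W0O p (Wp 0%N)).
exact: (WC n p (Wp n.+1)).
Qed.

(** * Sharply 3-transitive actions *)

Section TopologicalGroups.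
Variable G : topologicalGroupType.
Implicit Types (A B : set G) (g h : G).

Lemma compact_mulg A B : compact A -> compact B ->
  compact [set (g * h)%g | g in A & h in B].
Proof.
move=> cA cB; rewrite image2E.
have -> : uncurry (fun g h : G => g * h)%g = fun gh => (gh.1 * gh.2)%g.
  by apply/funext => -[].
apply: continuous_compact (compact_setX cA cB).
by apply: continuous_subspaceT; exact: mulg_continuous.
Qed.

Lemma compact_invg A : compact A -> compact [set g^-1%g | g in A].
Proof.
move=> cA; apply: continuous_compact cA.
by apply: continuous_subspaceT; exact: invg_continuous.
Qed.

Lemma relatively_compactM A B :
  relatively_compact A -> relatively_compact B ->
  relatively_compact [set (g * h)%g | g in A & h in B].
Proof.
move=> [K cK AK] [L cL BL]; exists [set (g * h)%g | g in K & h in L].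
  exact: compact_mulg.
by move=> _ [g /AK Kg [h /BL Lh <-]]; exists g => //; exists h.
Qed.

Lemma relatively_compactV A :
  relatively_compact A -> relatively_compact [set g^-1%g | g in A].
Proof.
move=> [K cK AK]; exists [set g^-1%g | g in K]; first exact: compact_invg.
by move=> _ [g /AK Kg <-]; exists g.
Qed.

Lemma relatively_compact_preimageV A :
  relatively_compact A -> relatively_compact [set g | A g^-1%g].
Proof.
move=> /relatively_compactV; apply: sub_relatively_compact => g Ag.
by exists g^-1%g; rewrite ?invgK.
Qed.

Lemma relatively_compact_preimageMr A h :
  relatively_compact A -> relatively_compact [set g | A (g * h)%g].
Proof.
move=> cA; have c1 : relatively_compact [set h^-1%g].
  by exists [set h^-1%g]; [exact: compact_set1|].
apply: sub_relatively_compact (relatively_compactM cA c1) => g Ag.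
by exists (g * h)%g => //; exists h^-1%g; rewrite // mulgK.
Qed.

Lemma mulg_continuousr h : continuous (fun g => g * h)%g.
Proof.
apply: (continuous_op2 (op := fun g h : G => (g * h)%g)).
- exact: mulg_continuous.
- exact: continuous_idfun.
- exact: continuous_cst.
Qed.

Lemma mulg_continuousl h : continuous (fun g => h * g)%g.
Proof.
apply: (continuous_op2 (op := fun g h : G => (g * h)%g)).
- exact: mulg_continuous.
- exact: continuous_cst.
- exact: continuous_idfun.
Qed.

End TopologicalGroups.

Record sharp_setting (G : topologicalGroupType) (M : topologicalType)
    (a : G -> M -> M) : Prop := SharpSetting {
  sharp_sigma_compact : sigma_compact G ;
  sharp_hausdorff : hausdorff_space M ;
  sharp_compact : compact [set: M] ;
  sharp_infinite : infinite_set [set: M] ;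
  sharp_disconnected : ~ connected [set: M] ;
  sharp_action : continuous_action a ;
  sharp_transitive : sharply_3_transitive a }.

Section SharpAction.
Variables (G : topologicalGroupType) (M : topologicalType) (a : G -> M -> M).
Hypothesis Ha : sharp_setting a.
Implicit Types (g h k : G) (x y z : M) (U : set M).

Lemma act1 x : a 1%g x = x.
Proof. by case: (sharp_action Ha) => -[]. Qed.

Lemma actM g h x : a (g * h)%g x = a g (a h x).
Proof. by case: (sharp_action Ha) => -[]. Qed.

Lemma actK g : cancel (a g) (a g^-1%g).
Proof. by move=> x; rewrite -actM mulVg act1. Qed.

Lemma actVK g : cancel (a g^-1%g) (a g).
Proof. by move=> x; rewrite -actM mulgV act1. Qed.

Lemma act_inj g : injective (a g).
Proof. exact: can_inj (actK g). Qed.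

Lemma act_pair_continuous : continuous (fun gx : G * M => a gx.1 gx.2).
Proof. by case: (sharp_action Ha). Qed.

Lemma act_continuous g : continuous (a g).
Proof.
apply: (continuous_op2 (op := a)).
- exact: act_pair_continuous.
- exact: continuous_cst.
- exact: continuous_idfun.
Qed.

Lemma orbit_continuous x : continuous (fun g => a g x).
Proof.
apply: (continuous_op2 (op := a)).
- exact: act_pair_continuous.
- exact: continuous_idfun.
- exact: continuous_cst.
Qed.

Lemma clopen_translate g U : clopen U -> clopen (a g @^-1` U).
Proof. by move=> cU; apply: preimage_clopen (@act_continuous g). Qed.

Lemma triple_transitive x y z x' y' z' :
  pairwise_distinct (x, y, z) -> pairwise_distinct (x', y', z') ->
  exists g, [/\ a g x = x', a g y = y' & a g z = z'].
Proof.
move=> xyz xyz'; have [_ /(_ _ _ xyz xyz')[g]] := sharp_transitive Ha.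
by case=> gx gy gz; exists g.
Qed.

Lemma exists_notin (s : seq M) : exists x, x \notin s.
Proof.
apply: contrapT => sM; apply: (sharp_infinite Ha).
apply: (sub_finite_set _ (finite_seq s)) => x _ /=.
by apply: contrapT => /negP xs; apply: sM; exists x.
Qed.

Lemma pair_transitive x y x' y' : x <> y -> x' <> y' ->
  exists g, a g x = x' /\ a g y = y'.
Proof.
move=> xy xy'; have [z] := exists_notin [:: x; y].
have [z'] := exists_notin [:: x'; y'].
rewrite !inE !negb_or => /andP[/eqP zx' /eqP zy'] /andP[/eqP zx /eqP zy].
have [||g [gx gy _]] := @triple_transitive x y z x' y' z'.
- by split=> //=; exact: nesym.
- by split=> //=; exact: nesym.
by exists g.
Qed.

Lemma exists_clopen : exists U, [/\ clopen U, U !=set0 & ~` U !=set0].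
Proof.
apply: contrapT => nU; apply: (sharp_disconnected Ha) => B B0.
rewrite /= => -[C oC BC] [D cD BD]; apply: contrapT => BT; apply: nU.
exists B; split=> //; first by split; [rewrite BC setTI|rewrite BD setTI].
by apply/set0P/eqP => B0'; apply: BT; rewrite -(setCK B) B0' setC0.
Qed.

(** By 2-transitivity any two distinct points can be moved to two points that one fixed clopen set
    separates. *)
Lemma sharp_zero_dimensional : zero_dimensional M.
Proof.
move=> x y /eqP xy; have [U [cU [u Uu] [v nUv]]] := exists_clopen.
have [|g [gx gy]] := @pair_transitive x y u v xy.
  by move=> uv; apply: nUv; rewrite -uv.
by exists (a g @^-1` U); split; rewrite /= ?gx ?gy //; exact: clopen_translate.
Qed.

Lemma clopen_separate x y : x <> y -> exists U, [/\ clopen U, U x & ~ U y].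
Proof. by move=> /eqP /sharp_zero_dimensional. Qed.

Lemma sharp_clopen_nbhs x (N : set M) :
  nbhs x N -> exists2 U, clopen U & U x /\ U `<=` N.
Proof.
exact: clopen_nbhs sharp_zero_dimensional (sharp_compact Ha).
Qed.

Lemma nbhs_neq x y : x <> y -> nbhs x [set z | z <> y].
Proof.
move=> /clopen_separate[U [[oU _] Ux nUy]].
by rewrite nbhsE; exists U => // z Uz zy; apply: nUy; rewrite -zy.
Qed.

Lemma nbhs_notin x (s : seq M) : x \notin s -> nbhs x [set z | z \notin s].
Proof.
elim: s => [|y s IH]; first by move=> _; exact: filterS filterT.
rewrite inE negb_or => /andP[/eqP /nbhs_neq xy /IH xs].
by near=> z; rewrite /= inE negb_or; apply/andP; split; [apply/eqP|]; near: z.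
Unshelve. all: by end_near. Qed.

(** By transitivity an isolated point makes all points isolated, and a compact discrete space is
    finite. *)
Lemma not_isolated x : ~ nbhs x [set x].
Proof.
move=> nx; have [|s [_ sM]] :=
  @compact_finite_cover _ [set: M] (fun y => [set y]) (sharp_compact Ha).
  move=> y _; have [x'] := exists_notin [:: x]; have [y'] := exists_notin [:: y].
  rewrite !inE => /eqP yy' /eqP xx'.
  have [g [gy _]] := pair_transitive (nesym yy') (nesym xx').
  have := @act_continuous g y [set x]; rewrite gy => /(_ nx) ny.
  apply: (@filterS _ _ _ (a g @^-1` [set x]) _ _ ny) => z /= gz.
  by apply: (@act_inj g); rewrite gz gy.
have [y /negP] := exists_notin s; apply.
by have [z zs ->] := sM y I.
Qed.

Lemma nbhs_infinite x (N : set M) (s : seq M) :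
  nbhs x N -> exists2 y, N y & y \notin s.
Proof.
move=> nN; apply: contrapT => Ns.
have nx : nbhs x [set z | z \notin [seq y <- s | y != x]].
  by apply: nbhs_notin; rewrite mem_filter eqxx.
apply: (@not_isolated x); near=> z => /=.
have Nz : N z by near: z.
have : z \notin [seq y <- s | y != x] by near: z.
rewrite mem_filter negb_and negbK => /orP[/eqP //|zs].
by exfalso; apply: Ns; exists z.
Unshelve. all: by end_near. Qed.

Lemma clopen_infinite U (s : seq M) : clopen U -> U !=set0 ->
  exists2 y, U y & y \notin s.
Proof.
by move=> [oU _] [x Ux]; apply: (@nbhs_infinite x); apply: open_nbhs_nbhs.
Qed.

End SharpAction.

(** * Properness on triples *)

(** For clopen sets in [s] separation is a clopen condition, unlike distinctness, so the triples
    satisfying [separated3 s] form a compact set; every triple of distinct points satisfies it for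
    some [s]. *)
Definition separated (M : Type) (s : seq (set M)) (x y : M) :=
  exists2 D, D \in s & (D x /\ ~ D y) \/ (D y /\ ~ D x).

Definition separated3 (M : Type) (s : seq (set M)) (x y z : M) :=
  [/\ separated s x y, separated s x z & separated s y z].

Section Separated.
Variables (T M : topologicalType).
Implicit Types s : seq (set M).

Lemma separated_neq s (x y : M) : separated s x y -> x <> y.
Proof. by move=> [D _ + xy]; rewrite xy => -[] []. Qed.

Lemma separated3_distinct s (x y z : M) :
  separated3 s x y z -> pairwise_distinct (x, y, z).
Proof. by move=> [] /separated_neq ? /separated_neq ? /separated_neq ?. Qed.

Lemma separated_sym s (x y : M) : separated s x y -> separated s y x.
Proof. by move=> [D Ds [?|?]]; exists D => //; [right|left]. Qed.

Lemma separated_sub s s' (x y : M) :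
  {subset s <= s'} -> separated s x y -> separated s' x y.
Proof. by move=> ss [D /ss Ds ?]; exists D. Qed.

Lemma separated3_sub s s' (x y z : M) :
  {subset s <= s'} -> separated3 s x y z -> separated3 s' x y z.
Proof. by move=> ss [? ? ?]; split; exact: (separated_sub ss). Qed.

Lemma clopen_separated s (f g : T -> M) : (forall D, D \in s -> clopen D) ->
  continuous f -> continuous g -> clopen [set t | separated s (f t) (g t)].
Proof.
move=> + cf cg; elim: s => [_|D s IH cs].
  rewrite (_ : [set _ | _] = set0); first exact: clopen0.
  by apply/seteqP; split=> // t [].
have cD : clopen D by apply: cs; rewrite mem_head.
have -> : [set t | separated (D :: s) (f t) (g t)] =
    ((f @^-1` D) `&` (g @^-1` (~` D)) `|` (g @^-1` D) `&` (f @^-1` (~` D)))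
    `|` [set t | separated s (f t) (g t)].
  apply/seteqP; split=> [t [E]|t [H|[E Es H]]].
  - by rewrite inE => /predU1P[->|Es] H; [left|right; exists E].
  - by exists D => //; rewrite mem_head.
  - by exists E => //; rewrite inE Es orbT.
apply: clopenU; last by apply: IH => E Es; apply: cs; rewrite inE Es orbT.
by apply: clopenU; apply: clopenI; apply: preimage_clopen => //; exact: clopenC.
Qed.

End Separated.

Section Properness.
Variables (G : topologicalGroupType) (M : topologicalType) (a : G -> M -> M).
Hypothesis Ha : sharp_setting a.
Implicit Types (g h k : G) (x y z : M) (U : set M) (s : seq (set M)).

Lemma clopen_separated3 s : (forall D, D \in s -> clopen D) ->
  clopen [set t : M * M * M | separated3 s t.1.1 t.1.2 t.2].
Proof.
move=> cs.
have c12 : continuous (fun t : M * M * M => t.1.1).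
  by apply: continuous_compose; exact: fst_continuous.
have c22 : continuous (fun t : M * M * M => t.1.2).
  apply: (continuous_compose (g := snd) (f := fst)).
    exact: snd_continuous.
  exact: fst_continuous.
have c3 : continuous (fun t : M * M * M => t.2) by exact: snd_continuous.
have -> : [set t : M * M * M | separated3 s t.1.1 t.1.2 t.2] =
    [set t | separated s t.1.1 t.1.2] `&` [set t | separated s t.1.1 t.2]
    `&` [set t | separated s t.1.2 t.2].
  by apply/seteqP; split=> [t []|t [[]]].
by do 2?[apply: clopenI]; exact: clopen_separated.
Qed.

Lemma distinct_separated3 x y z : pairwise_distinct (x, y, z) ->
  exists2 s, (forall D, D \in s -> clopen D) & separated3 s x y z.
Proof.
move=> [/= /(clopen_separate Ha)[A [cA Ax nAy]]].
move=> /(clopen_separate Ha)[B [cB Bx nBz]] /(clopen_separate Ha)[C [cC Cy nCz]].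
exists [:: A; B; C]; first by move=> D; rewrite !inE => /or3P[] /eqP ->.
split; [exists A|exists B|exists C]; rewrite ?inE ?eqxx ?orbT //; by left.
Qed.

Lemma open_distinct : open [set t : M * M * M | pairwise_distinct t].
Proof.
rewrite openE => -[[x y] z] /distinct_separated3[s cs xyz].
rewrite /interior nbhsE; have [oS _] := clopen_separated3 cs.
exists [set t : M * M * M | separated3 s t.1.1 t.1.2 t.2] => //.
by move=> [[x' y'] z'] /separated3_distinct.
Qed.

Lemma exists_distinct : exists t : M * M * M, pairwise_distinct t.
Proof.
have [x _] := exists_notin Ha [::]; have [y] := exists_notin Ha [:: x].
rewrite inE => /eqP yx; have [z] := exists_notin Ha [:: x; y].
rewrite !inE negb_or => /andP[/eqP zx /eqP zy].
by exists (x, y, z); split=> //=; exact: nesym.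
Qed.

Lemma diag3_continuous g : continuous (diag3 a g).
Proof.
apply: continuous_pair; first apply: continuous_pair.
- apply: (continuous_compose (g := a g) (f := fun t : M * M * M => t.1.1)).
    exact: act_continuous.
  by apply: continuous_compose; exact: fst_continuous.
- apply: (continuous_compose (g := a g) (f := fun t : M * M * M => t.1.2)).
    exact: act_continuous.
  by apply: (continuous_compose (g := snd) (f := fst));
    [exact: snd_continuous|exact: fst_continuous].
- apply: (continuous_compose (g := a g) (f := fun t : M * M * M => t.2)).
    exact: act_continuous.
  exact: snd_continuous.
Qed.

Lemma orbit3_continuous (t : M * M * M) : continuous (fun g => diag3 a g t).
Proof.
by apply: continuous_pair; first apply: continuous_pair; exact: orbit_continuous.
Qed.

Lemma compact_triples : compact [set: M * M * M].
Proof. by rewrite -!setXTT; do 2?[apply: compact_setX]; exact: sharp_compact Ha. Qed.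

Lemma zero_dimensional_triples : zero_dimensional (M * M * M)%type.
Proof.
by do 2?[apply: zero_dimensional_pair]; exact: sharp_zero_dimensional Ha.
Qed.

(** The orbits of [t] under the countably many compact sets covering [G] are closed and cover the
    open set of distinct triples, so Baire's theorem applies. *)
Lemma orbit3_interior : exists (t p : M * M * M) (K : set G),
  [/\ pairwise_distinct t, compact K, pairwise_distinct p
    & nbhs p [set diag3 a g t | g in K]].
Proof.
have [t Dt] := exists_distinct; have [K cK KT] := sharp_sigma_compact Ha.
have [||||||n [p np]] := @compact_baire _
    (fun n => [set diag3 a g t | g in K n]) [set t | pairwise_distinct t].
- exact: zero_dimensional_triples.
- exact: compact_triples.
- move=> n; apply: compact_closed.
    exact: zero_dimensional_hausdorff zero_dimensional_triples.
  by apply: continuous_compact (cK n); apply: continuous_subspaceT;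
    exact: orbit3_continuous.
- exact: open_distinct.
- by exists t.
- move=> u Du; have [_ /(_ t u Dt Du)[g gt]] := sharp_transitive Ha.
  have : [set: G] g by []; rewrite -KT => -[n _ Kng].
  by exists n => //; exists g.
exists t, p, (K n); split=> //.
have [g _ <-] := nbhs_singleton np; case: Dt => t1 t2 t3.
by split=> /= /(act_inj Ha).
Qed.

(* By Baire's theorem the orbit of some compact set has interior in the space
   of triples, which makes the orbit maps open. *)
Lemma triples_proper s : (forall D, D \in s -> clopen D) ->
  relatively_compact [set g | exists x y z,
    separated3 s x y z /\ separated3 s (a g x) (a g y) (a g z)].
Proof.
move=> cs; have [t [p [K [Dt cK Dp np]]]] := orbit3_interior.
have /choice[h hP] : forall u, exists h, pairwise_distinct u -> diag3 a h u = p.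
  move=> u; have [Du|] := pselect (pairwise_distinct u); last by exists 1%g.
  by have [_ /(_ u p Du Dp)[h]] := sharp_transitive Ha; exists h.
pose L := [set u : M * M * M | separated3 s u.1.1 u.1.2 u.2].
have LD u : L u -> pairwise_distinct u.
  by case: u => -[x y] z /separated3_distinct.
have cL : compact L.
  apply: (subclosed_compact (clopen_separated3 cs).2 compact_triples) => //.
(* Each [u] in [L] is moved to [p] by [h u]; the preimages of the neighbourhood of [p] cover the
   compact set [L]. *)
have [|l [_ lL]] := @compact_finite_cover _ L
    (fun u => diag3 a (h u) @^-1` [set diag3 a g t | g in K]) cL.
  move=> u /LD/hP hu.
  have := @diag3_continuous (h u) u [set diag3 a g t | g in K].
  by rewrite hu; exact.
apply: (@sub_relatively_compact _ _ [set g | exists2 u, u \in l &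
    exists2 v, v \in l & exists2 k, K k &
    exists2 k', K k' & g = ((h v)^-1 * k' * (k^-1 * h u))%g]).
  move=> g [x [y [z [Lxyz Lgxyz]]]].
  have [u ul [k Kk ek]] := lL (x, y, z) Lxyz.
  have [v vl [k' Kk' ek']] := lL (a g x, a g y, a g z) Lgxyz.
  exists u => //; exists v => //; exists k => //; exists k' => //.
  (* This product fixes the triple [t], so it is 1 by freeness; solving for [g] gives the expression
     above. *)
  have e : diag3 a ((k'^-1 * h v * g) * ((h u)^-1 * k))%g t = t.
    move: t {Dt np lL} ek ek' => -[[t1 t2] t3] [e1 e2 e3] [f1 f2 f3].
    rewrite /diag3 /= !(actM Ha) e1 e2 e3 !(actK Ha) -f1 -f2 -f3.
    by rewrite !(actK Ha).
  have [/(_ t Dt _ e) + _] := sharp_transitive Ha.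
  move=> /(congr1 (fun w => (h v)^-1 * k' * w * (k^-1 * h u))%g).
  by rewrite mulg1 => <-; rewrite !mulgA !mulgK mulVg mul1g mulgVK.
apply: relatively_compact_seq => u _; apply: relatively_compact_seq => v _.
have cpt1 g : relatively_compact [set g] by exists [set g] => //; exact: compact_set1.
have cKK : relatively_compact K by exists K.
apply: sub_relatively_compact (relatively_compactM (relatively_compactM
  (cpt1 (h v)^-1%g) cKK) (relatively_compactM (relatively_compactV cKK) (cpt1 (h u)))).
move=> g [k Kk [k' Kk' ->]]; exists ((h v)^-1 * k')%g.
  by exists (h v)^-1%g => //; exists k'.
exists (k^-1 * h u)%g => //; exists k^-1%g; first by exists k.
by exists (h u).
Qed.

End Properness.

(** * Dynamics on the compact space *)

Lemma relatively_compact_near_seq (S T : topologicalType) (I : eqType)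
    (l : seq I) (F : I -> T -> set S) (x : T) :
  (forall i, i \in l -> exists2 N, nbhs x N &
     relatively_compact [set y | exists2 x', N x' & F i x' y]) ->
  exists2 N, nbhs x N & relatively_compact
    [set y | exists2 x', N x' & exists2 i, i \in l & F i x' y].
Proof.
elim: l => [_|i l IH lN].
  exists setT; first exact: filterT.
  by apply: sub_relatively_compact (@relatively_compact0 S) => y [x' _ []].
have [N nN cN] := lN i (mem_head _ _).
have [|N' nN' cN'] := IH; first by move=> j jl; apply: lN; rewrite inE jl orbT.
exists (N `&` N'); first exact: filterI.
apply: sub_relatively_compact (relatively_compactU cN cN').
move=> y [x' [Nx' N'x'] [j]]; rewrite inE => /predU1P[->|jl] Fy.
  by left; exists x'.
by right; exists x' => //; exists j.
Qed.

Definition triple_pairs (M : Type) (t : M * M * M) :=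
  [:: (t.1.1, t.1.2); (t.1.1, t.2); (t.1.2, t.2)].

(** At least two of the three positions are in [U]. The pair is kept explicit because properness is
    applied to two points on each side. *)
Definition majority (M : choiceType) (U : set M) (t : M * M * M) :=
  exists2 p, p \in triple_pairs t & U p.1 /\ U p.2.

Section Majority.
Variable M : choiceType.
Implicit Types (U : set M) (t : M * M * M).

Lemma majorityP U (t : M * M * M) : majority U t <->
  [\/ U t.1.1 /\ U t.1.2, U t.1.1 /\ U t.2 | U t.1.2 /\ U t.2].
Proof.
split=> [[p]|].
  by rewrite !inE => /or3P[] /eqP -> /=; [exact: Or31|exact: Or32|exact: Or33].
by case=> H; [exists (t.1.1, t.1.2)|exists (t.1.1, t.2)|exists (t.1.2, t.2)];
  rewrite // !inE eqxx ?orbT.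
Qed.

Lemma majorityC U t : ~ majority U t <-> majority (~` U) t.
Proof.
have or3E (P Q R : Prop) : [\/ P, Q | R] <-> P \/ Q \/ R.
  by split=> [[]|[|[]]]; [left|right; left|right; right|exact: Or31
    |exact: Or32|exact: Or33].
rewrite !majorityP !or3E /setC /=.
by have := EM (U t.1.1); have := EM (U t.1.2); have := EM (U t.2); tauto.
Qed.

End Majority.

Section Dynamics.
Variables (G : topologicalGroupType) (M : topologicalType) (a : G -> M -> M).
Hypothesis Ha : sharp_setting a.
Implicit Types (g h k : G) (x y z : M) (U : set M) (s : seq (set M)).

Lemma clopen_notin x (l : seq M) : x \notin l ->
  exists U, [/\ clopen U, U x & forall y, y \in l -> ~ U y].
Proof.
move=> /(nbhs_notin Ha) /(sharp_clopen_nbhs Ha)[U cU [Ux UN]].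
by exists U; split=> // y yl /UN /=; rewrite yl.
Qed.

(** Three points of [U] have three different membership patterns in [W1], [W2]; [u] and [v] realise
    at most two of them, which leaves one point separated from both. *)
Lemma escape U : clopen U -> U !=set0 -> exists2 s,
  (forall D, D \in s -> clopen D) &
  forall u v, exists2 e, U e & separated s u e /\ separated s v e.
Proof.
move=> cU U0; have [e1 Ue1 _] := clopen_infinite Ha [::] cU U0.
have [e2 Ue2] := clopen_infinite Ha [:: e1] cU U0; rewrite inE => e21.
have [e3 Ue3] := clopen_infinite Ha [:: e1; e2] cU U0.
rewrite !inE negb_or => /andP[e31 e32].
have [|W1 [cW1 W1e1 nW1]] := @clopen_notin e1 [:: e2; e3].
  by rewrite !inE negb_or eq_sym e21 eq_sym e31.
have [|W2 [cW2 W2e2 nW2]] := @clopen_notin e2 [:: e1; e3].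
  by rewrite !inE negb_or e21 eq_sym e32.
have nW12 : ~ W1 e2 by apply: nW1; rewrite inE eqxx.
have nW13 : ~ W1 e3 by apply: nW1; rewrite !inE eqxx orbT.
have nW21 : ~ W2 e1 by apply: nW2; rewrite inE eqxx.
have nW23 : ~ W2 e3 by apply: nW2; rewrite !inE eqxx orbT.
exists [:: W1; W2]; first by move=> D; rewrite !inE => /orP[] /eqP ->.
have s1 u : ~ W1 u -> separated [:: W1; W2] u e1.
  by move=> W1u; exists W1; [rewrite inE eqxx|right].
have s2 u : W1 u \/ ~ W2 u -> separated [:: W1; W2] u e2.
  by move=> [W1u|W2u]; [exists W1|exists W2];
    rewrite ?inE ?eqxx ?orbT //; [left|right].
have s3 u : W1 u \/ W2 u -> separated [:: W1; W2] u e3.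
  by move=> [W1u|W2u]; [exists W1|exists W2];
    rewrite ?inE ?eqxx ?orbT //; left.
move=> u v.
have [u1|u1] := pselect (W1 u); have [v1|v1] := pselect (W1 v); last first.
- by exists e1 => //; split; exact: s1.
- have [u2|u2] := pselect (W2 u).
    by exists e3 => //; split; apply: s3; [right|left].
  by exists e2 => //; split; apply: s2; [right|left].
- have [v2|v2] := pselect (W2 v).
    by exists e3 => //; split; apply: s3; [left|right].
  by exists e2 => //; split; apply: s2; [left|right].
- by exists e2 => //; split; apply: s2; left.
Qed.

(* The third vertex used to contradict properness is the g-preimage of a point
   of U away from the images of x and y. *)
Lemma four_points_proper A1 A2 A3 A4 U :
  clopen A1 -> clopen A2 -> clopen A3 -> clopen A4 -> clopen U ->
  A1 `&` A2 = set0 -> A3 `&` A4 = set0 ->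
  (A1 `|` A2) `&` (A3 `|` A4) = set0 ->
  relatively_compact [set g | exists x y z w,
    [/\ A1 x, A2 y, A3 z & A4 w] /\
    [/\ U (a g x), U (a g y), ~ U (a g z) & ~ U (a g w)]].
Proof.
move=> c1 c2 c3 c4 cU d12 d34 d.
have [[u0 Uu0]|U0] := pselect (U !=set0); last first.
  apply: sub_relatively_compact (@relatively_compact0 G).
  by move=> g [x [y [z [w [_ []]]]]] Ugx; exfalso; apply: U0; exists (a g x).
have [s cs sU] := escape cU (ex_intro _ u0 Uu0).
pose s' := [:: A1; A2; A3; A4; U] ++ s.
have cs' D : D \in s' -> clopen D.
  by rewrite mem_cat !inE => /orP[/or4P[| | |/orP[]] /eqP -> //|/cs].
apply: sub_relatively_compact (triples_proper Ha cs').
move=> g [x [y [z [w [[A1x A2y A3z A4w] [Ux Uy Uz Uw]]]]]].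
have [e Ue [ue ve]] := sU (a g x) (a g y).
have sub : {subset s <= s'} by move=> D Ds; rewrite mem_cat Ds orbT.
pose o := a g^-1%g e; have go : a g o = e by rewrite /o (actVK Ha).
have n12 u : A1 u -> ~ A2 u.
  by move=> Au Bu; have : (A1 `&` A2) u by []; rewrite d12.
have n34 u : A3 u -> ~ A4 u.
  by move=> Au Bu; have : (A3 `&` A4) u by []; rewrite d34.
have nd u : (A1 `|` A2) u -> ~ (A3 `|` A4) u.
  by move=> Au Bu; have : ((A1 `|` A2) `&` (A3 `|` A4)) u by []; rewrite d.
(* [A1] and [A2] are disjoint, so one of them misses [o]; [p] is the point among [x], [y] lying in
   that one. The sets [A3], [A4] give [q] in the same way. *)
have [p [A [As' Ap no Up [pe AA]]]] : exists p A,
   [/\ A \in s', A p, ~ A o, U (a g p) & separated s' (a g p) e /\ A `<=` A1 `|` A2].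
  have [A1o|A1o] := pselect (A1 o).
    exists y, A2; split=> //; [by rewrite mem_cat !inE eqxx ?orbT|exact: n12|].
    by split; [exact: separated_sub ve|move=> ?; right].
  exists x, A1; split=> //; first by rewrite mem_cat !inE eqxx ?orbT.
  by split; [exact: separated_sub ue|move=> ?; left].
have [q [B [Bs' Bq nBo Uq BB]]] : exists q B,
   [/\ B \in s', B q, ~ B o, ~ U (a g q) & B `<=` A3 `|` A4].
  have [A3o|A3o] := pselect (A3 o).
    exists w, A4; split=> //.
    - by rewrite mem_cat !inE eqxx ?orbT.
    - exact: n34.
  exists z, A3; split=> //.
  by rewrite mem_cat !inE eqxx ?orbT.
have Us' : U \in s' by rewrite mem_cat !inE eqxx ?orbT.
(* The triple is separated by [A] and [B] before applying [g], and by [U] and the sets in [s]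
   afterwards. *)
exists p, q, o; rewrite go; split; split.
- by exists A => //; left; split=> // Aq; apply: (@nd q); [exact: AA|exact: BB].
- by exists A => //; left.
- by exists B => //; left.
- by exists U => //; left.
- exact: pe.
- by exists U => //; right.
Qed.

End Dynamics.

(** * Sides of a clopen set and their boundaries *)

Section MajorityDynamics.
Variables (G : topologicalGroupType) (M : topologicalType) (a : G -> M -> M).
Hypothesis Ha : sharp_setting a.
Implicit Types (g h k : G) (x y z : M) (U : set M).

(** The points [x], [y], [a s0 z], [a s0 w] are put in disjoint clopen sets; for [s] near [s0] the
    points [a s z], [a s w] stay in theirs, and [four_points_proper] applies uniformly. *)
Lemma four_points_near U s0 x y z w : clopen U -> x <> y -> z <> w ->
  x \notin [:: a s0 z; a s0 w] -> y \notin [:: a s0 z; a s0 w] ->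
  exists2 N, nbhs s0 N & relatively_compact [set g | exists2 s, N s &
    (U (a g x) /\ U (a g y)) /\
    (~ U (a (g * s)%g z) /\ ~ U (a (g * s)%g w))].
Proof.
move=> cU xy zw; rewrite !inE !negb_or.
move=> /andP[/eqP xz /eqP xw] /andP[/eqP yz /eqP yw].
have zw' : a s0 z <> a s0 w by move=> /(act_inj Ha).
have [|A [cA Ax nA]] := @clopen_notin _ _ _ Ha x [:: y; a s0 z; a s0 w].
  by rewrite !inE !negb_or; apply/and3P; split; apply/eqP.
have [|B [cB By nB]] := @clopen_notin _ _ _ Ha y [:: a s0 z; a s0 w].
  by rewrite !inE !negb_or; apply/andP; split; apply/eqP.
have [C [cC Cz nC]] := clopen_separate Ha zw'.
have nAy : ~ A y by apply: nA; rewrite !inE eqxx.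
have nAz : ~ A (a s0 z) by apply: nA; rewrite !inE eqxx !orbT.
have nAw : ~ A (a s0 w) by apply: nA; rewrite !inE eqxx !orbT.
have nBz : ~ B (a s0 z) by apply: nB; rewrite !inE eqxx.
have nBw : ~ B (a s0 w) by apply: nB; rewrite !inE eqxx !orbT.
pose D := ~` (A `|` B).
have cD : clopen D by apply: clopenC => //; exact: clopenU.
have := @four_points_proper _ _ _ Ha A (B `&` ~` A) (D `&` C) (D `&` ~` C) U.
move=> [] //.
- by apply: clopenI => //; exact: clopenC.
- exact: clopenI.
- by apply: clopenI => //; exact: clopenC.
- by rewrite setIC -setIA setICl setI0.
- by rewrite setIACA setICr setI0.
- rewrite -setIUr setUv setIT /D; apply/seteqP; split=> // t [tAB]; apply.
  by case: tAB => [|[]]; [left|right].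
move=> K cK KP.
have nz := @orbit_continuous _ _ _ Ha z s0; have nw := @orbit_continuous _ _ _ Ha w s0.
exists ((fun s => a s z) @^-1` (D `&` C) `&` (fun s => a s w) @^-1` (D `&` ~` C)).
  apply: filterI.
    apply: nz; apply: open_nbhs_nbhs; split; last by split=> // -[].
    by apply: openI; [case: cD|case: cC].
  apply: nw; apply: open_nbhs_nbhs; split; last by split=> // -[].
  by apply: openI; [case: cD|apply: closed_openC; case: cC].
exists K => // g [s [Ds Dw] [[Ux Uy] [Uz Uw]]]; apply: KP.
by exists x, y, (a s z), (a s w); rewrite -!(actM Ha).
Qed.

Lemma triple_pairs_neq (t : M * M * M) p : pairwise_distinct t ->
  p \in triple_pairs t -> p.1 <> p.2.
Proof. by move=> [? ? ?]; rewrite !inE => /or3P[] /eqP ->. Qed.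

Definition triple_points (t : M * M * M) := [:: t.1.1; t.1.2; t.2].

Lemma triple_pairs_points (t : M * M * M) p : p \in triple_pairs t ->
  p.1 \in triple_points t /\ p.2 \in triple_points t.
Proof. by rewrite !inE => /or3P[] /eqP -> /=; rewrite !eqxx !orbT. Qed.

Lemma majority_diag3 U g (t : M * M * M) : majority U (diag3 a g t) <->
  exists2 p, p \in triple_pairs t & U (a g p.1) /\ U (a g p.2).
Proof.
split=> [[p]|[p]]; rewrite !inE.
  by move=> /or3P[] /eqP -> /= [? ?]; [exists (t.1.1, t.1.2)
    |exists (t.1.1, t.2)|exists (t.1.2, t.2)]; rewrite // !inE eqxx ?orbT.
move=> /or3P[] /eqP -> /= ?; [exists (a g t.1.1, a g t.1.2)
  |exists (a g t.1.1, a g t.2)|exists (a g t.1.2, a g t.2)];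
  by rewrite // !inE eqxx ?orbT.
Qed.

Lemma majority_preimage U g h (t : M * M * M) :
  majority (a g @^-1` U) (diag3 a h t) <-> majority U (diag3 a (g * h)%g t).
Proof.
rewrite !majority_diag3; split=> -[p tp Up]; exists p => //; move: Up;
  by rewrite /= !(actM Ha).
Qed.

(** Opposite sides are witnessed by a pair of entries of each triple, so nine applications of
    [four_points_near] suffice. *)
Lemma majority_near U (t t' : M * M * M) s0 : clopen U ->
  pairwise_distinct t -> pairwise_distinct t' ->
  (forall x y, x \in triple_points t -> y \in triple_points t' -> x <> a s0 y) ->
  exists2 N, nbhs s0 N & relatively_compact [set g | exists2 s, N s &
    majority U (diag3 a g t) /\ ~ majority U (diag3 a (g * s)%g t')].
Proof.
move=> cU Dt Dt' tt'.
pose F (pq : (M * M) * (M * M)) s g := (U (a g pq.1.1) /\ U (a g pq.1.2)) /\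
    (~ U (a (g * s)%g pq.2.1) /\ ~ U (a (g * s)%g pq.2.2)).
have [|N nN cN] := @relatively_compact_near_seq _ _ _
    [seq (p, q) | p <- triple_pairs t, q <- triple_pairs t'] F s0.
  move=> _ /allpairsP[[p q] [tp tq ->]].
  have [p1 p2] := triple_pairs_points tp.
  have [q1 q2] := triple_pairs_points tq.
  apply: four_points_near => //.
  - exact: triple_pairs_neq tp.
  - exact: triple_pairs_neq tq.
  - by rewrite !inE negb_or; apply/andP; split; apply/eqP; exact: tt'.
  - by rewrite !inE negb_or; apply/andP; split; apply/eqP; exact: tt'.
exists N => //; apply: sub_relatively_compact cN.
move=> g [s Ns [/majority_diag3[p tp Up] /majorityC /majority_diag3[q tq Uq]]].
exists s => //; exists (p, q) => //.
by apply/allpairsP; exists (p, q).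
Qed.

Lemma exists_distinct_notin (l : seq M) : exists2 t : M * M * M,
  pairwise_distinct t & forall x, x \in triple_points t -> x \notin l.
Proof.
have [x xl] := exists_notin Ha l; have [y] := exists_notin Ha (x :: l).
rewrite inE negb_or => /andP[/eqP yx yl].
have [z] := exists_notin Ha [:: x, y & l].
rewrite !inE !negb_or => /and3P[/eqP zx /eqP zy zl].
exists (x, y, z); first by split=> //=; exact: nesym.
by move=> u; rewrite !inE => /or3P[] /eqP ->.
Qed.

(* Passing through a third triple, disjoint from t and s.t, allows t and s.t to
   overlap. *)
Lemma majority_boundary U (t : M * M * M) (S : set G) : clopen U ->
  pairwise_distinct t -> relatively_compact S ->
  relatively_compact [set g | exists2 s, S s &
    majority U (diag3 a g t) /\ ~ majority U (diag3 a (g * s)%g t)].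
Proof.
move=> cU Dt [K cK SK].
apply: (@sub_relatively_compact _ _ [set g | exists2 s, K s &
    majority U (diag3 a g t) /\ ~ majority U (diag3 a (g * s)%g t)]).
  by move=> g [s /SK Ks H]; exists s.
apply: relatively_compact_near => // s0 _.
have [t' Dt' tt'] := exists_distinct_notin
  (triple_points t ++ [seq a s0 x | x <- triple_points t]).
have [|N nN cN] := @majority_near U t t' 1%g cU Dt Dt'.
  move=> x y xt /tt'; rewrite (act1 Ha) mem_cat negb_or => /andP[yt _] xy.
  by move: yt; rewrite -xy xt.
have [|N' nN' cN'] := @majority_near U t' t s0 cU Dt' Dt.
  move=> x y /tt'; rewrite mem_cat negb_or => /andP[_ yt] xt xy.
  by move: yt; rewrite xy map_f.
exists N' => //; apply: sub_relatively_compact (relatively_compactU cN cN').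
move=> g [s Ns [gt gst]].
have [gt'|gt'] := pselect (majority U (diag3 a g t')); first by right; exists s.
by left; exists 1%g; [exact: nbhs_singleton nN|rewrite mulg1].
Qed.

(** When no set of a finite subcover holds two entries of [g.t], the covering sets separate these
    entries pairwise, and properness on triples applies. *)
Lemma majority_cover (t : M * M * M) (U : M -> set M) : pairwise_distinct t ->
  (forall m, clopen (U m)) -> (forall m, U m m) ->
  exists l : seq M, relatively_compact
    [set g | forall m, m \in l -> ~ majority (U m) (diag3 a g t)].
Proof.
move=> Dt cU UU; have [|l [_ lU]] := compact_finite_cover (U := U) (sharp_compact Ha).
  by move=> m _; apply: open_nbhs_nbhs; split=> //; have [] := cU m.
exists l; move: t Dt => [[x y] z] /[dup] Dt /(distinct_separated3 Ha)[s cs st].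
have cs' D : D \in s ++ map U l -> clopen D.
  by rewrite mem_cat => /orP[/cs//|/mapP[m _ ->]].
apply: sub_relatively_compact (triples_proper Ha cs') => g /= gl.
exists x, y, z; split.
  by apply: separated3_sub st => D Ds; rewrite mem_cat Ds.
have sep u v : (u, v) \in triple_pairs (a g x, a g y, a g z) ->
    separated (s ++ map U l) u v.
  move=> uv; have [m ml Umu] := lU u I; exists (U m).
    by rewrite mem_cat (map_f U ml) orbT.
  by left; split=> // Umv; apply: (gl m ml); exists (u, v).
by split; apply: sep; rewrite !inE eqxx ?orbT.
Qed.

End MajorityDynamics.

(** * Contracting elements and shrinking sequences *)

Section Contraction.
Variables (G : topologicalGroupType) (M : topologicalType) (a : G -> M -> M).
Hypothesis Ha : sharp_setting a.
Implicit Types (g h k : G) (x y z m : M) (U N : set M) (B : set G).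

(* k sends (m, y, p) to (c, e, b) with y close to m. *)
Lemma contracting U m N B : clopen U -> U !=set0 -> ~` U !=set0 ->
  nbhs m N -> relatively_compact B ->
  exists k, [/\ ~ B k, U (a k m) & a k @^-1` U `<=` N].
Proof.
move=> cU U0 [b nUb] nN cB.
have [c Uc _] := clopen_infinite Ha [::] cU U0.
have [e Ue] := clopen_infinite Ha [:: c] cU U0; rewrite inE => /eqP ec.
have [p] := exists_notin Ha [:: m]; rewrite inE => /eqP pm.
have [p'] := exists_notin Ha [:: m; p].
rewrite !inE negb_or => /andP[/eqP p'm /eqP p'p].
have [|N0 cN0 [N0m N0N]] := @sharp_clopen_nbhs _ _ _ Ha m
    (N `&` [set z | z \notin [:: p; p']]).
  apply: filterI => //; apply: (nbhs_notin Ha).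
  by rewrite !inE negb_or; apply/andP; split; apply/eqP; exact: nesym.
have N0p : ~ N0 p by move=> /N0N[_] /=; rewrite inE eqxx.
have N0p' : ~ N0 p' by move=> /N0N[_] /=; rewrite !inE eqxx orbT.
have [W [cW Wc nWe]] := clopen_separate Ha (nesym ec).
have [P [cP Pp nPp']] := clopen_separate Ha (nesym p'p).
pose s := [:: N0; P; U; W].
have cs D : D \in s -> clopen D by rewrite !inE => /or4P[] /eqP ->.
have [K cK BK] := relatively_compactU cB (triples_proper Ha cs).
(* [Z] consists of the points taken to [e] by some element of [K] that takes [m] to [c]. It is
   closed and misses [m] because [c] and [e] differ, so [y] can be chosen near [m] and outside [Z],
   which keeps [k] out of [K]. *)
pose Z := [set a k^-1%g e | k in K `&` [set k | a k m = c]].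
have cZ : closed Z.
  apply: compact_closed; first exact: sharp_hausdorff Ha.
  apply: continuous_compact.
    apply: continuous_subspaceT.
    exact: (continuous_compose (@orbit_continuous _ _ _ Ha e) (@invg_continuous G)).
  apply: compact_closedI => //.
  apply: (closed_comp (f := fun k => a k m) (D := [set c])).
    by move=> k _; exact: (@orbit_continuous _ _ _ Ha m).
  by apply: accessible_closed_set1; apply: hausdorff_accessible;
    exact: sharp_hausdorff Ha.
have [y [N0y nZy]] : exists2 y, (N0 `&` ~` Z) y & y \notin [:: m].
  apply: (nbhs_infinite Ha (x := m)); apply: filterI.
    by apply: open_nbhs_nbhs; split=> //; case: cN0.
  apply: open_nbhs_nbhs; split; first exact: closed_openC.
  by move=> [k [_ /= kc] km]; apply: ec; rewrite -kc -km (actVK Ha).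
rewrite inE => /eqP ym.
have yp : y <> p by move=> yp; apply: N0p; rewrite -yp.
have [||k [km ky kp]] := triple_transitive Ha (x := m) (y := y) (z := p)
    (x' := c) (y' := e) (z' := b).
- by split=> //=; exact: nesym.
- split=> //=; first exact: nesym.
    by move=> cb; apply: nUb; rewrite -cb.
  by move=> eb; apply: nUb; rewrite -eb.
have nKk : ~ K k.
  by move=> Kk; apply: nZy; exists k => //; rewrite -ky (actK Ha).
(* Completed by whichever of [m], [y] has its image separated by [W] from that of [q], the points
   [q] and [r] would give a triple that puts [k] in [K]. *)
have key q r : ~ N0 q -> ~ N0 r -> separated s q r ->
    U (a k q) -> ~ U (a k r) -> False.
  move=> N0q N0r qr Ukq Ukr; apply: nKk; apply: BK; right.
  have [Wq|Wq] := pselect (W (a k q)).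
    exists y, q, r; rewrite ky; split; split=> //.
    - by exists N0; [rewrite !inE eqxx|left].
    - by exists N0; [rewrite !inE eqxx|left].
    - by exists W; [rewrite !inE eqxx !orbT|right].
    - by exists U; [rewrite !inE eqxx !orbT|left].
    - by exists U; [rewrite !inE eqxx !orbT|left].
  exists m, q, r; rewrite km; split; split=> //.
  - by exists N0; [rewrite !inE eqxx|left].
  - by exists N0; [rewrite !inE eqxx|left].
  - by exists W; [rewrite !inE eqxx !orbT|left].
  - by exists U; [rewrite !inE eqxx !orbT|left].
  - by exists U; [rewrite !inE eqxx !orbT|left].
exists k; split; [|by rewrite km|].
  by move=> Bk; apply: nKk; apply: BK; left.
have Ukp' : ~ U (a k p').
  move=> Ukp'; apply: (key p' p) => //; last by rewrite kp.
  by exists P; [rewrite !inE eqxx !orbT|right].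
(* A point outside [N0] mapped into [U] is separated by [P] from [p] or from [p'], both of which are
   mapped outside [U]. *)
move=> q /= Ukq; suff : N0 q by move=> /N0N[].
apply: contrapT => N0q.
have [Pq|Pq] := pselect (P q).
  apply: (key q p') => //.
  by exists P; [rewrite !inE eqxx !orbT|left].
apply: (key q p) => //; last by rewrite kp.
by exists P; [rewrite !inE eqxx !orbT|right].
Qed.

(** Membership of [a g' x] in the clopen set [U] is locally constant in both variables, and
    compactness of [M] makes the neighbourhood of [g] uniform in [x]. *)
Lemma translate_near U g : clopen U ->
  \forall g' \near g, a g' @^-1` U = a g @^-1` U.
Proof.
move=> cU.
suff : \forall g' \near g, [set: M] `<=` [set x | U (a g' x) <-> U (a g x)].
  by apply: filterS => g' gg'; apply/seteqP; split=> x /= /(gg' x I).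
apply: ((compact_near_coveringP [set: M]).1 (sharp_compact Ha) _ (nbhs g)
  (fun g' x => U (a g' x) <-> U (a g x))) => x _.
have ngx : nbhs (a g x) [set y | U y <-> U (a g x)].
  have [Ux|nUx] := pselect (U (a g x)).
    apply: (@filterS _ _ _ U) => [y Uy|]; first by split.
    by apply: open_nbhs_nbhs; split=> //; case: cU.
  apply: (@filterS _ _ _ (~` U)) => [y nUy|]; first by split.
  by apply: open_nbhs_nbhs; split=> //; apply: closed_openC; case: cU.
have /= [[A B] [/= nA nB] AB] := @act_pair_continuous _ _ _ Ha (g, x) _ ngx.
have nB' := @act_continuous _ _ _ Ha g x _ ngx.
exists (B `&` (a g) @^-1` [set y | U y <-> U (a g x)], A); first by split=> //=; exact: filterI.
move=> [x' g'] /= [[Bx' gx'] Ag'].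
by have /= := AB (g', x') (conj Ag' Bx') ; rewrite gx'.
Qed.

Lemma finite_translates U B : clopen U -> relatively_compact B ->
  exists l : seq G, forall g, B g -> exists2 d, d \in l &
    a d @^-1` U = a g @^-1` U.
Proof.
move=> cU [K cK BK]; have [|l [_ lK]] :=
  @compact_finite_cover _ K (fun g => [set g' | a g' @^-1` U = a g @^-1` U]) cK.
  by move=> g _; exact: translate_near.
by exists l => g /BK /lK[d dl /= gd]; exists d.
Qed.

(** Strictness of the inclusion makes iterated preimages of [U] pairwise different, which forces
    products of such elements to leave every compact set. *)
Definition shrinks U d := a d @^-1` U `<=` U /\ exists2 x, U x & ~ U (a d x).

Lemma exists_shrinks U : clopen U -> U !=set0 -> ~` U !=set0 ->
  exists D : seq G, (forall d, d \in D -> shrinks U d) /\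
    forall x, U x -> exists2 d, d \in D & U (a d x).
Proof.
move=> cU U0 nU0.
have /choice[d dP] : forall x, exists d, U x -> U (a d x) /\ shrinks U d.
  move=> x; have [Ux|] := pselect (U x); last by exists 1%g.
  have [y Uy] := clopen_infinite Ha [:: x] cU U0; rewrite inE => /eqP yx.
  (* Removing [y] from the target neighbourhood makes the inclusion in [U] strict. *)
  have [||k [_ Ukx kU]] := @contracting U x (U `&` [set z | z <> y]) set0 cU U0 nU0.
  - apply: filterI; last exact: (nbhs_neq Ha (nesym yx)).
    by apply: open_nbhs_nbhs; split=> //; case: cU.
  - exact: relatively_compact0.
  exists k => _; split=> //; split; first by move=> z /kU[].
  by exists y => // /kU[].
have [||l [lU Ul]] := @compact_finite_cover _ U (fun x => a (d x) @^-1` U).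
- by apply: (subclosed_compact _ (sharp_compact Ha)) => //; case: cU.
- move=> x /dP[Udx _]; apply: open_nbhs_nbhs; split=> //.
  by have [] := clopen_translate Ha (d x) cU.
exists (map d l); split.
  by move=> _ /mapP[x /lU /dP[_ ?] ->].
by move=> x /Ul[y yl Uy]; exists (d y); rewrite ?map_f.
Qed.

(** Each step multiplies by an element of [D] that keeps the image of [x] in [U]. The strictly
    decreasing preimages of [U] are infinitely many, while a relatively compact set of elements
    yields finitely many by [finite_translates], so [u] escapes it. *)
Lemma shrinking_sequence U (D : seq G) x : clopen U -> ~` U !=set0 ->
  (forall d, d \in D -> shrinks U d) ->
  (forall x, U x -> exists2 d, d \in D & U (a d x)) -> U x ->
  exists u : nat -> G, [/\ u 0%N = 1%g,
    forall n, exists2 d, d \in D & u n.+1 = (d * u n)%g,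
    forall n, U (a (u n) x) /\ a (u n.+1) @^-1` U `<=` a (u n) @^-1` U,
    forall B, relatively_compact B -> exists n, forall i, (n <= i)%N -> ~ B (u i)
    & forall y, y <> x -> exists n, ~ U (a (u n) y)].
Proof.
move=> cU nU0 DS DU Ux.
have /choice[f fP] : forall y, exists d, U y -> d \in D /\ U (a d y).
  move=> y; have [Uy|] := pselect (U y); last by exists 1%g.
  by have [d ? ?] := DU y Uy; exists d.
pose u := fix u n := if n is n'.+1 then (f (a (u n') x) * u n')%g else 1%g.
have uU n : U (a (u n) x).
  by elim: n => [|n IH] /=; rewrite ?(act1 Ha) // (actM Ha); have [] := fP _ IH.
have uD n : exists2 d, d \in D & u n.+1 = (d * u n)%g.
  by have [? ?] := fP _ (uU n); exists (f (a (u n) x)).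
have uS n : a (u n.+1) @^-1` U `<=` a (u n) @^-1` U.
  move=> y; have [d /DS[dU _] ->] := uD n.
  by rewrite /= (actM Ha) => /dU.
have umono i j : (i <= j)%N -> a (u j) @^-1` U `<=` a (u i) @^-1` U.
  move=> /subnK <-; elim: (j - i)%N => // n IH; rewrite addSn.
  exact: subset_trans (uS _) IH.
have uneq i j : (i < j)%N -> a (u i) @^-1` U <> a (u j) @^-1` U.
  move=> ij eij; have [d /DS[_ [y Uy nUy]] ui] := uD i.
  have : (a (u j) @^-1` U) (a (u i)^-1%g y).
    by rewrite -eij /= (actVK Ha).
  by move=> /(umono _ _ ij); rewrite ui /= (actM Ha) (actVK Ha).
have esc B : relatively_compact B -> exists n, forall i, (n <= i)%N -> ~ B (u i).
  move=> cB; have [l lB] := finite_translates cU cB.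
  apply: contrapT => nB.
  have {}nB n : exists2 i, (n <= i)%N & B (u i).
    apply: contrapT => nBn; apply: nB; exists n => i ni Bi; apply: nBn.
    by exists i.
  have [v [vi vB]] : exists v : nat -> nat, (forall n, v n < v n.+1)%N /\
      forall n, B (u (v n)).
    have /choice[w wP] : forall n, exists i, (n <= i)%N /\ B (u i).
      by move=> n; have [i ? ?] := nB n; exists i.
    exists (fun n => iter n (fun i => w i.+1) (w 0%N)); split=> [n|[|n]] /=.
    - by have [] := wP (iter n (fun i => w i.+1) (w 0%N)).+1.
    - by have [] := wP 0%N.
    - by have [] := wP (iter n (fun i => w i.+1) (w 0%N)).+1.
  have vlt i j : (i < j)%N -> (v i < v j)%N.
    elim: j => // j IH; rewrite ltnS leq_eqVlt => /predU1P[->//|/IH ij].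
    exact: ltn_trans ij (vi j).
  have : uniq [seq a (u (v i)) @^-1` U | i <- iota 0 (size l).+1].
    rewrite map_inj_uniq ?iota_uniq // => i j eij.
    by apply/eqP; case: ltngtP => // /vlt /uneq; [|move=> /nesym].
  move=> /(@uniq_leq_size _ _ [seq a d @^-1` U | d <- l]).
  rewrite !size_map size_iota ltnn => F; apply: notF; apply: F => V.
  move=> /mapP[i _ ->]; have [d dl <-] := lB _ (vB i).
  exact: (map_f (fun d => a d @^-1` U)).
exists u; split=> // y yx; apply: contrapT => nUy.
have {}nUy n : U (a (u n) y) by apply: contrapT => ?; apply: nUy; exists n.
(* If [y] never left [U], two points would stay in [U] and two outside under every [u n], which
   confines the whole sequence to a relatively compact set. *)
have [z nUz _] := clopen_infinite Ha [::] (clopenC U cU) nU0.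
have [w nUw] := clopen_infinite Ha [:: z] (clopenC U cU) nU0.
rewrite inE => /eqP wz.
have nu n v : ~ U v -> ~ U (a (u n) v).
  by move=> nUv /(umono 0%N n (leq0n n)); rewrite /= (act1 Ha).
have xy' : y \notin [:: a 1%g z; a 1%g w] /\ x \notin [:: a 1%g z; a 1%g w].
  rewrite !(act1 Ha) !inE !negb_or; split; apply/andP; split; apply/eqP => e.
  - by apply: nUz; have := nUy 0%N; rewrite /= (act1 Ha) e.
  - by apply: nUw; have := nUy 0%N; rewrite /= (act1 Ha) e.
  - by apply: nUz; rewrite -e.
  - by apply: nUw; rewrite -e.
have [N nN cN] := four_points_near Ha cU yx (nesym wz) xy'.1 xy'.2.
have [n /(_ n (leqnn n))] := esc _ cN; apply.
by exists 1%g; [exact: nbhs_singleton nN|rewrite mulg1; split; split; try exact: nu].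
Qed.

End Contraction.

(** * Compact generation *)

Section WordProducts.
Variable G : groupType.
Implicit Types (S : set G) (g h : G).

Lemma word_productsD S m n g h : word_products S m g -> word_products S n h ->
  word_products S (m + n) (g * h)%g.
Proof.
move=> Sg; elim: n h => [|n IH] h /=; first by move=> ->; rewrite mulg1 addn0.
rewrite addnS => -[k /IH Sgk [s Ss <-]].
by exists (g * k)%g => //; exists s; rewrite ?mulgA.
Qed.

Lemma word_products1 S s : S s -> word_products S 1 s.
Proof. by move=> Ss; exists 1%g => //; exists s; [left|rewrite mul1g]. Qed.

Lemma word_productsV S n g : word_products S n g -> word_products S n g^-1%g.
Proof.
elim: n g => [|n IH] g /=; first by move=> ->; rewrite invg1.
move=> [h /IH Sh [s Ss <-]]; rewrite invgM.
have S1 : word_products S 1 s^-1%g.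
  exists 1%g => //; exists s^-1%g; last by rewrite mul1g.
  by case: Ss => [Ss|[t St <-]]; [right; exists s|rewrite invgK; left].
exact: (word_productsD S1 Sh).
Qed.

Lemma word_products_sub S T n : S `<=` T ->
  word_products S n `<=` word_products T n.
Proof.
move=> ST; elim: n => // n IH g [h /IH Th [s Ss <-]]; exists h => //.
exists s => //; case: Ss => [/ST|[t /ST Tt <-]]; first by left.
by right; exists t.
Qed.

End WordProducts.

Section Generation.
Variables (G : topologicalGroupType) (M : topologicalType) (a : G -> M -> M).
Hypothesis Ha : sharp_setting a.
Implicit Types (g h k : G) (x y z m : M).

Variables (U : set M) (D D' : seq G).
Hypotheses (cU : clopen U) (U0 : ~` U !=set0).
Hypothesis D_shrinks : forall d, d \in D -> shrinks a U d.
Hypothesis D_cover : forall x, U x -> exists2 d, d \in D & U (a d x).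
Hypothesis D'_avoids : forall d, d \in D' -> a d @^-1` U `<=` ~` U.
Hypothesis D'_cover : forall x, ~ U x -> exists2 d, d \in D' & U (a d x).

Let H := \bigcup_n word_products [set` D ++ D'] n.
Let s := U :: [seq a d @^-1` U | d <- D ++ D'].
(** The triples separated by [s] form a compact set, so reducing every triple makes [H] act
    cocompactly on triples. *)
Let reducible x y z := exists2 h, H h & separated3 s (a h x) (a h y) (a h z).

Let HM g h : H g -> H h -> H (g * h)%g.
Proof. by move=> [m _ Hm] [n _ Hn]; exists (m + n)%N => //; exact: word_productsD. Qed.

Let HD d : d \in D ++ D' -> H d.
Proof. by move=> dD; exists 1%N => //; exact: word_products1. Qed.

Let H1 : H 1%g.
Proof. by exists 0%N. Qed.

Let reducible_translate h x y z :
  H h -> reducible (a h x) (a h y) (a h z) -> reducible x y z.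
Proof.
by move=> Hh [k Hk kh]; exists (k * h)%g; [exact: HM|rewrite !(actM Ha)].
Qed.

Let reducible_swap x y z : reducible x y z -> reducible y x z.
Proof.
by move=> [h Hh [? ? ?]]; exists h => //; split=> //; exact: separated_sym.
Qed.

Let reducible_rot x y z : reducible x y z -> reducible z x y.
Proof.
by move=> [h Hh [? ? ?]]; exists h => //; split=> //; exact: separated_sym.
Qed.

Let Us : U \in s. Proof. by rewrite inE eqxx. Qed.

Let ds d : d \in D ++ D' -> a d @^-1` U \in s.
Proof. by move=> dD; rewrite inE (map_f (fun d => a d @^-1` U)) ?orbT. Qed.

Let shrink x : U x -> exists u : nat -> G, [/\ forall n, H (u n),
  forall n, U (a (u n) x),
  forall n, exists2 d, d \in D & u n.+1 = (d * u n)%g,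
  u 0%N = 1%g /\ forall n, a (u n) @^-1` U `<=` U
  & forall y, y <> x -> exists n, ~ U (a (u n) y)].
Proof.
move=> Ux; have [u [u0 uD uU _ uy]] := shrinking_sequence Ha cU U0 D_shrinks D_cover Ux.
exists u; split=> //.
- elim=> [|n IH]; first by rewrite u0.
  have [d dD ->] := uD n; apply: HM => //; apply: HD.
  by rewrite mem_cat dD.
- by move=> n; case: (uU n).
- split=> // n; elim: n => [|n IH]; first by rewrite u0 => y /=; rewrite (act1 Ha).
  by apply: subset_trans IH; case: (uU n).
Qed.

(** A shrinking sequence keeps [x] in [U] and eventually expels [y]. Just before the expulsion by
    [d], the preimage of [U] under [d] separates [x] from [y], while [z] is still outside [U]. *)
Let reducible_in2 x y z : x <> y -> U x -> U y -> ~ U z -> reducible x y z.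
Proof.
move=> xy Ux Uy Uz; have [u [uH uU uD [u0 uS] /(_ y (nesym xy)) uy]] := shrink Ux.
have /ex_minnP[n] : exists n, `[< ~ U (a (u n) y) >].
  by have [n Un] := uy; exists n; apply/asboolP.
case: n => [/asboolP|n /asboolP nUy nmin]; first by rewrite u0 (act1 Ha).
have Uny : U (a (u n) y).
  by apply: contrapT => nU; have := nmin n; rewrite ltnn => F; apply: notF;
    apply: F; apply/asboolP.
have [d dD und] := uD n; exists (u n) => //.
have nUz : ~ U (a (u n) z) by move=> /(uS n).
split; [exists (a d @^-1` U)|exists U|exists U] => //; try by left.
  by apply: ds; rewrite mem_cat dD.
by left; split; rewrite /= -(actM Ha) -und.
Qed.

(** An element [d] of [D'] brings [x] into [U] and [z] out of it. Either [y] also enters [U], which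
    is the previous case, or the preimage of [U] under [d] already separates [x] from [y]. *)
Let reducible_in1 x y z : x <> y -> ~ U x -> ~ U y -> U z -> reducible x y z.
Proof.
move=> xy Ux Uy Uz; have [d dD' Udx] := D'_cover Ux.
have dD : d \in D ++ D' by rewrite mem_cat dD' orbT.
have nUdz : ~ U (a d z) by move=> /(D'_avoids dD').
have [Udy|Udy] := pselect (U (a d y)).
  apply: (reducible_translate (HD dD)); apply: reducible_in2 => //.
  by move=> /(act_inj Ha).
exists 1%g => //; rewrite !(act1 Ha).
split; [exists (a d @^-1` U); first exact: ds|exists U|exists U] => //;
  by [left|right].
Qed.

(** A shrinking sequence at [x] moves the triple until [y] has left [U]; what remains is a
    permutation of the previous cases. *)
Let reducible_in x y z : pairwise_distinct (x, y, z) -> U x -> reducible x y z.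
Proof.
move=> [/= xy xz yz] Ux.
have base x' y' z' : x' <> y' -> x' <> z' -> y' <> z' ->
    U x' -> ~ (U y' /\ U z') -> reducible x' y' z'.
  move=> xy' xz' yz' Ux' nyz.
  have [Uy'|Uy'] := pselect (U y').
    by apply: reducible_in2 => // Uz'; apply: nyz.
  have [Uz'|Uz'] := pselect (U z').
    by apply/reducible_rot/reducible_rot/reducible_swap/reducible_in2.
  by apply/reducible_rot; exact: reducible_in1.
have [u [uH uU _ _ /(_ y (nesym xy))[n nUy]]] := shrink Ux.
apply: (reducible_translate (uH n)); apply: base => //; try by move=> /(act_inj Ha).
by move=> [].
Qed.

Lemma triple_reducible x y z : pairwise_distinct (x, y, z) ->
  exists2 h, (\bigcup_n word_products [set` D ++ D'] n) h &
    separated3 (U :: [seq a d @^-1` U | d <- D ++ D']) (a h x) (a h y) (a h z).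
Proof.
move=> Dxyz; have [/= xy xz yz] := Dxyz; rewrite -/(reducible x y z).
have [Ux|Ux] := pselect (U x); first exact: reducible_in.
have [d dD' Udx] := D'_cover Ux.
apply: (@reducible_translate d); first by apply: HD; rewrite mem_cat dD' orbT.
by apply: reducible_in => //; split=> /= /(act_inj Ha).
Qed.

End Generation.

Section CompactGeneration.
Variables (G : topologicalGroupType) (M : topologicalType) (a : G -> M -> M).
Hypothesis Ha : sharp_setting a.

(** For a fixed triple [t] and any [g], a product [h] of generators brings [g.t] back to a separated
    triple. By properness [h * g] lies in a compact set [K], so [K], [D] and [D'] generate [G]. *)
Lemma compactly_generated : exists2 S : set G, compact S & generates S.
Proof.
have [U [cU U0 nU0]] := exists_clopen Ha.
have [D [DS DU]] := exists_shrinks Ha cU U0 nU0.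
have [D' [DS' DU']] : exists D' : seq G,
    (forall d, d \in D' -> a d @^-1` U `<=` ~` U) /\
    forall x, ~ U x -> exists2 d, d \in D' & U (a d x).
  have cnU := clopenC U cU.
  have /choice[d dP] : forall x, exists d, ~ U x -> U (a d x) /\
      a d @^-1` U `<=` ~` U.
    move=> x; have [Ux|nUx] := pselect (U x); first by exists 1%g.
    have [||k [_ kx kU]] := @contracting _ _ _ Ha U x (~` U) set0 cU U0 nU0.
    - by apply: open_nbhs_nbhs; split=> //; case: cnU.
    - exact: relatively_compact0.
    by exists k.
  have [||l [lU Ul]] := @compact_finite_cover _ (~` U) (fun x => a (d x) @^-1` U).
  - by apply: (subclosed_compact _ (sharp_compact Ha)) => //; case: cnU.
  - move=> x /dP[Udx _]; apply: open_nbhs_nbhs; split=> //.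
    by have [] := clopen_translate Ha (d x) cU.
  exists (map d l); split; first by move=> _ /mapP[x /lU /dP[_ ?] ->].
  by move=> x /Ul[y yl Uy]; exists (d y); rewrite ?map_f.
have [t] := exists_distinct Ha; case: t => -[x y] z Dt.
have [s cs st] := distinct_separated3 Ha Dt.
pose s' := U :: [seq a d @^-1` U | d <- D ++ D'].
have css' E : E \in s ++ s' -> clopen E.
  rewrite mem_cat => /orP[/cs//|]; rewrite inE => /predU1P[->//|].
  by move=> /mapP[d _ ->]; exact: clopen_translate.
have [K cK KP] := triples_proper Ha css'.
exists (K `|` [set` D ++ D']).
  by apply: compactU => //; apply: finite_compact; exact: finite_seq.
apply/seteqP; split=> // g _.
have [|h [n _ Hh] hg] := @triple_reducible _ _ _ Ha U D D' cU nU0 DS DU DS' DU'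
  (a g x) (a g y) (a g z).
  by case: Dt => /= ? ? ?; split=> /= /(act_inj Ha).
have Khg : K (h * g)%g.
  apply: KP; exists x, y, z; split.
    by apply: separated3_sub st => E Es; rewrite mem_cat Es.
  by rewrite !(actM Ha); apply: separated3_sub hg => E Es; rewrite mem_cat Es orbT.
exists (n + 1)%N => //; rewrite -(mulKg h g); apply: word_productsD.
  apply: word_productsV; apply: word_products_sub Hh.
  by move=> d; right.
by apply: word_products1; left.
Qed.

End CompactGeneration.

(** * Geodesic spaces *)

Local Open Scope ring_scope.

Section Between.
Variables (R : realType) (X : metricType R).
Implicit Types (x y z p q : X).

(** In a geodesic space this says that [p] is on some geodesic from [x] to [y]; geodesic triangles
    are handled through it without parametrised curves. *)
Definition between x p y := mdist x p + mdist p y = mdist x y.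

Lemma betweenxx x y : between x x y.
Proof. by rewrite /between mdistxx add0r. Qed.

Lemma between_sym x p y : between x p y -> between y p x.
Proof. by rewrite /between addrC !(metric_sym y) !(metric_sym _ x) !(metric_sym p). Qed.

Lemma between_trans x p q y : between x p y -> between p q y -> between x q y.
Proof.
rewrite /between => xpy pqy; have := metric_triangle x q y.
have := metric_triangle x p q; lra.
Qed.

Hypothesis gX : geodesic_metric X.

Lemma interpolate x y (s : R) : 0 <= s <= mdist x y ->
  exists2 p, between x p y & mdist x p = s.
Proof.
move=> sxy; have [c [cx cy cst]] := gX x y; have /andP[s0 s1] := sxy.
have e1 : mdist x (c s) = s.
  have := cst 0 s; rewrite cx lexx mdist_ge0 => -> //.
  by rewrite sub0r normrN ger0_norm.
have e2 : mdist (c s) y = mdist x y - s.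
  have := cst s (mdist x y); rewrite cy lexx mdist_ge0 => -> //.
  by rewrite distrC ger0_norm // subr_ge0.
by exists (c s) => //; rewrite /between e1 e2 addrC subrK.
Qed.

Lemma exists_natr_ge (r : R) : exists n : nat, r <= n%:R.
Proof.
exists (Num.truncn `|r|).+1; apply: le_trans (ler_norm r) _.
by apply: ltW; exact: truncnS_gt.
Qed.

(** A point [p] of the side [x z] close to both [x o] and [o z] is at distance at most
    [(x|z)_o + 2 * D + 2] from [o]. Thinness of [x y z] gives a point within [D] of [p] on [x y] or
    [y z], and its distance to [o] is at least [(x|y)_o] or [(y|z)_o]. *)
Lemma thin_hyperbolic (D : R) : 0 <= D ->
  (forall x y z p, between x p z -> exists q,
     (between x q y \/ between y q z) /\ mdist p q <= D) ->
  gromov_hyperbolic (@mdist R X).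
Proof.
move=> D0 thin; exists (3 * D + 2); first lra.
move=> o x y z.
have [p [pxz [q qxo pq] [q' qoz pq']]] : exists p, [/\ between x p z,
    exists2 q, between x q o & mdist p q <= D + 1 &
    exists2 q', between o q' z & mdist p q' <= D + 1].
  (* In a walk from [x] to [z] by steps of length 1, the last point before the walk leaves the
     neighbourhood of [x o] is within [D + 1] of [o z]. *)
  suff walk n p : between x p z ->
      (exists2 q, between x q o & mdist p q <= D + 1) ->
      mdist p z <= n%:R -> exists p, [/\ between x p z,
        exists2 q, between x q o & mdist p q <= D + 1 &
        exists2 q', between o q' z & mdist p q' <= D + 1].
    have [n xzn] := exists_natr_ge (mdist x z).
    apply: (walk n x) => //; first exact: betweenxx.
    by exists x; [exact: betweenxx|rewrite mdistxx; lra].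
  elim: n p => [|n IH] p pxz xo pzn.
    exists p; split=> //; exists z; last by lra.
    exact/between_sym/betweenxx.
  have [pz1|pz1] := leP (mdist p z) 1.
    exists p; split=> //; exists z; last by lra.
    exact/between_sym/betweenxx.
  have [|p1 p1pz pp1] := @interpolate p z 1; first by apply/andP; split; lra.
  have xp1z := between_trans pxz p1pz.
  have [q1 [[q1x|q1z] p1q1]] := thin x o z p1 xp1z.
    apply: (IH p1) => //; first by exists q1 => //; lra.
    by move: p1pz pzn; rewrite /between -natr1; lra.
  exists p; split=> //; exists q1 => //.
  by have := metric_triangle p p1 q1; lra.
have op : mdist o p <= gromov_product mdist o x z + 2 * D + 2.
  move: qxo qoz pxz; rewrite /between /gromov_product !(metric_sym _ o).
  have := metric_triangle x q p; have := metric_triangle o q p.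
  have := metric_triangle p q' z; have := metric_triangle o q' p.
  rewrite (metric_sym q p) (metric_sym q' p); lra.
have [r [rxyz pr]] := thin x y z p pxz.
have or : mdist o r <= mdist o p + D by have := metric_triangle o p r; lra.
rewrite lerBlDr ge_min; apply/orP.
case: rxyz; rewrite /between => b; [left|right].
- have := metric_triangle o r x; have := metric_triangle o r y.
  rewrite (metric_sym r x) /gromov_product; rewrite /gromov_product in op; lra.
- have := metric_triangle o r y; have := metric_triangle o r z.
  rewrite (metric_sym r y) /gromov_product; rewrite /gromov_product in op; lra.
Qed.

Lemma compact_bounded_mdist (o : X) (K : set X) : compact K ->
  exists r : R, forall x, K x -> mdist o x <= r.
Proof.
move=> cK; have [|s [_ sK]] := @compact_finite_cover _ K (fun x => ball x 1) cK.
  by move=> x _; exact: nbhsx_ballx.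
exists (\sum_(x <- s) mdist o x + 1) => y /sK[x xs].
rewrite ballEmdist /= => xy; apply: le_trans (metric_triangle o x y) _.
apply: lerD; last exact: ltW.
rewrite (big_rem x) //= lerDl sumr_ge0 // => z _; exact: mdist_ge0.
Qed.

End Between.

(** * Geometric actions *)

(** Gromov hyperbolicity is not a field because it is to be proved for all such spaces. *)
Record geometric_setting (R : realType) (G : topologicalGroupType)
    (X : metricType R) (b : G -> X -> X) : Prop := GeometricSetting {
  geometric_proper : proper_metric X ;
  geometric_geodesic : geodesic_metric X ;
  geometric_action : continuous_action b ;
  geometric_isometric : forall g x y, mdist (b g x) (b g y) = mdist x y ;
  geometric_proper_action : proper_action b ;
  geometric_cocompact : cocompact_action b }.

Section GeometricAction.
Variables (R : realType) (G : topologicalGroupType) (X : metricType R).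
Variables (b : G -> X -> X) (o : X).
Hypothesis Hb : geometric_setting b.
Implicit Types (g h k : G) (x y z p q : X) (B : set G) (r C : R).

Let b1 x : b 1%g x = x.
Proof. by case: (geometric_action Hb) => -[]. Qed.

Let bM g h x : b (g * h)%g x = b g (b h x).
Proof. by case: (geometric_action Hb) => -[]. Qed.

(** A point of [X] has no side of its own; it inherits that of a group element whose orbit point is
    [C]-close to it. *)
Definition near_orbit C x g := mdist x (b g o) <= C.

Lemma near_orbit_translate C g x h :
  near_orbit C x h -> near_orbit C (b g x) (g * h)%g.
Proof. by rewrite /near_orbit bM (geometric_isometric Hb). Qed.

Lemma between_translate g x p y :
  between x p y -> between (b g x) (b g p) (b g y).
Proof. by rewrite /between !(geometric_isometric Hb). Qed.

Lemma orbit_cobounded : exists C, 0 <= C /\ forall x, exists g, near_orbit C x g.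
Proof.
have [K cK KT] := geometric_cocompact Hb.
have [r Kr] := compact_bounded_mdist o cK.
exists `|r|; split=> // x; have : [set: X] x by [].
rewrite -KT => -[g _ [y Ky <-]]; exists g.
rewrite /near_orbit (geometric_isometric Hb) metric_sym.
exact: le_trans (Kr y Ky) (ler_norm r).
Qed.

Lemma relatively_compact_bounded B : relatively_compact B ->
  exists r, forall g, B g -> mdist o (b g o) <= r.
Proof.
move=> [K cK BK].
have [|r Kr] := @compact_bounded_mdist R X o [set b g o | g in K].
  apply: continuous_compact cK; apply: continuous_subspaceT.
  apply: (continuous_op2 (op := b)).
  - by case: (geometric_action Hb).
  - exact: continuous_idfun.
  - exact: continuous_cst.
by exists r => g /BK Kg; apply: Kr; exists g.
Qed.

Lemma bounded_relatively_compact r :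
  relatively_compact [set g | mdist o (b g o) <= r].
Proof.
exists [set g | (b g @` [set y | mdist o y <= r]) `&` [set y | mdist o y <= r] !=set0].
  by apply: (geometric_proper_action Hb); exact: (geometric_proper Hb).
move=> g /= gr; exists (b g o); split=> //.
by exists o => //=; rewrite mdistxx; exact: le_trans (mdist_ge0 _ _) gr.
Qed.

(** * Hyperbolicity of geometric actions *)

Variables (M : topologicalType) (a : G -> M -> M).
Hypothesis Ha : sharp_setting a.
Variable (t : M * M * M).
Hypothesis Dt : pairwise_distinct t.
Implicit Types (U : set M) (m : M).

Local Notation side U g := (majority U (diag3 a g t)).

(** In a walk by unit steps on a geodesic from [x] to [y] the side changes at some step, and by
    [majority_boundary] this can only happen near [o]. *)
Lemma crossing C U : clopen U -> exists r, forall x y g h,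
  near_orbit C x g -> near_orbit C y h -> side U g -> ~ side U h ->
  exists2 p, between x p y & mdist o p <= r.
Proof.
move=> cU; have [C0 [C00 orb]] := orbit_cobounded.
pose C1 := Num.max C C0.
have CC1 : C <= C1 by rewrite le_max lexx.
have C0C1 : C0 <= C1 by rewrite le_max lexx orbT.
(* Two points at distance at most 1, each [C1]-close to an orbit point, have these orbit points at
   distance at most [2 * C1 + 1]. *)
have := majority_boundary Ha cU Dt (bounded_relatively_compact (2 * C1 + 1)).
move=> /relatively_compact_bounded[r0 Br0].
exists (r0 + C1).
have step x y g h : near_orbit C1 x g -> near_orbit C1 y h -> mdist x y <= 1 ->
    side U g -> ~ side U h -> mdist o x <= r0 + C1.
  move=> xg yh xy Ug Uh; have : mdist o (b g o) <= r0.
    apply: Br0; exists (g^-1 * h)%g; last by rewrite mulVKg.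
    rewrite /= -(geometric_isometric Hb g) -bM mulVKg.
    have := metric_triangle (b g o) x (b h o); have := metric_triangle x y (b h o).
    rewrite (metric_sym (b g o) x); move: xg yh; rewrite /near_orbit; lra.
  have := metric_triangle o (b g o) x; rewrite (metric_sym (b g o) x).
  by move: xg; rewrite /near_orbit; lra.
move=> x y g h xg yh Ug Uh.
have {}xg : near_orbit C1 x g by exact: le_trans CC1.
have {}yh : near_orbit C1 y h by exact: le_trans CC1.
have [n] := exists_natr_ge (mdist x y).
elim: n x g xg Ug => [|n IH] x g xg Ug xyn.
  by exists x; [exact: betweenxx|apply: (step x y g h) => //; lra].
have [xy1|xy1] := leP (mdist x y) 1.
  by exists x; [exact: betweenxx|apply: (step x y g h)].
have [|p xpy xp] := @interpolate _ _ (geometric_geodesic Hb) x y 1.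
  by apply/andP; split; lra.
have [k pk] := orb p.
have {}pk : near_orbit C1 p k by exact: le_trans C0C1.
have [Uk|Uk] := pselect (side U k).
  have [|q pqy oq] := IH p k pk Uk.
    by move: xpy xyn; rewrite /between -natr1; lra.
  by exists q => //; exact: between_trans pqy.
by exists x; [exact: betweenxx|apply: (step x p g k) => //; rewrite xp].
Qed.

(* A geodesic from the U-side to k and back to the U-side meets a fixed ball
   on both sides of k, so k cannot be far away. *)
Lemma no_return C r U : clopen U -> exists r', forall x z p g h k,
  near_orbit C x g -> near_orbit C z h -> between x p z -> mdist o p <= r ->
  side U (k * g)%g -> side U (k * h)%g -> ~ side U k -> mdist o (b k o) <= r'.
Proof.
move=> cU; have [r1 cross] := crossing (Num.max C r) cU.
exists (2 * r1 + r) => x z p g h k xg zh xpz op Ukg Ukh Uk.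
have kxg : near_orbit (Num.max C r) (b k x) (k * g)%g.
  by apply: near_orbit_translate; apply: le_trans xg _; rewrite le_max lexx.
have kzh : near_orbit (Num.max C r) (b k z) (k * h)%g.
  by apply: near_orbit_translate; apply: le_trans zh _; rewrite le_max lexx.
have kp : near_orbit (Num.max C r) (b k p) k.
  rewrite /near_orbit (geometric_isometric Hb) metric_sym.
  by apply: le_trans op _; rewrite le_max lexx orbT.
have [p1 b1' op1] := cross _ _ _ _ kxg kp Ukg Uk.
have [p2 b2' op2] := cross _ _ _ _ kzh kp Ukh Uk.
(* On the translated geodesic [b k p] lies between [p1] and [p2], both [r1]-close to [o]; so it is
   within [2 * r1] of [o], and [b k o] is within [r] of it. *)
have := between_translate k xpz; move: b1' b2'; rewrite /between.
have := metric_triangle (b k x) p1 (b k z); have := metric_triangle p1 p2 (b k z).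
have := metric_triangle p1 o p2.
have := metric_triangle o p1 (b k p); have := metric_triangle o p2 (b k p).
have := metric_triangle o (b k p) (b k o).
rewrite (geometric_isometric Hb k p o) (metric_sym p o) (metric_sym p1 o).
rewrite (metric_sym (b k z) p2) (metric_sym (b k z) (b k p)); lra.
Qed.

(** [N] is shrunk to contain no entry of [t] except possibly [m], so at most one entry is sent into
    [U]. The element is far away because [contracting] avoids those of displacement at most [r]. *)
Lemma far_contracting U m (N : set M) r : clopen U -> U !=set0 -> ~` U !=set0 ->
  nbhs m N -> exists k, [/\ r < mdist o (b k o), U (a k m), ~ side U k
    & a k @^-1` U `<=` N].
Proof.
move=> cU U0 nU0 nN.
have nN' : nbhs m (N `&` [set z | z \in triple_points t -> z = m]).
  apply: filterI => //.
  have /(nbhs_notin Ha) : m \notin [seq x <- triple_points t | x != m].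
    by rewrite mem_filter eqxx.
  apply: filterS => z; rewrite /mkset mem_filter negb_and negbK.
  by move=> /orP[/eqP ->//|/negP].
have [k [Bk Ukm kN]] := contracting Ha cU U0 nU0 nN' (bounded_relatively_compact r).
exists k; split=> //.
- by rewrite ltNge; apply/negP.
- move=> /majority_diag3[p tp [/kN[_ p1] /kN[_ p2]]].
  have [q1 q2] := triple_pairs_points tp; apply: (triple_pairs_neq Dt tp).
  by rewrite (p1 q1) (p2 q2).
- by move=> z /kN[].
Qed.

(** The preimages of [U] under the elements of [far_contracting] cover [M]; by [majority_cover]
    finitely many of them catch two entries of [g.t] for every [g] of large displacement. *)
Lemma far_cover U r : clopen U -> U !=set0 -> ~` U !=set0 ->
  exists (l : seq G) (r' : R),
    (forall k, k \in l -> r < mdist o (b k o) /\ ~ side U k) /\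
    forall g, r' < mdist o (b g o) -> exists2 k, k \in l & side U (k * g)%g.
Proof.
move=> cU U0 nU0.
have /choice[k kP] : forall m, exists k,
    [/\ r < mdist o (b k o), U (a k m) & ~ side U k].
  move=> m; have [k [? ? ? _]] := far_contracting r cU U0 nU0 (@filterT _ (nbhs m) _).
  by exists k.
have [l] := majority_cover Ha Dt (U := fun m => a (k m) @^-1` U)
  (fun m => clopen_translate Ha (k m) cU) (fun m => let: And3 _ Ukm _ := kP m in Ukm).
move=> /relatively_compact_bounded[r' lr'].
exists (map k l), r'; split=> [_ /mapP[m _ ->]|g gr']; first by have [] := kP m.
have : exists2 m, m \in l & majority (a (k m) @^-1` U) (diag3 a g t).
  apply: contrapT => nl; have : mdist o (b g o) <= r'.
    by apply: lr' => m ml Um; apply: nl; exists m.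
  by rewrite leNgt gr'.
move=> [m ml /(majority_preimage Ha) Ukg]; exists (k m) => //.
exact: map_f.
Qed.

Lemma finite_crossing C U (l : seq G) : clopen U -> exists r, forall k x y g h,
  k \in l -> near_orbit C x g -> near_orbit C y h ->
  side U (k * g)%g -> ~ side U (k * h)%g ->
  exists2 p, between x p y & mdist o p <= r.
Proof.
move=> cU; elim: l => [|k l [r IH]]; first by exists 0.
have [r' cross] := crossing C (clopen_translate Ha k cU).
exists (Num.max r r') => k' x y g h; rewrite inE => /predU1P[->|k'l] xg yh.
  move=> /(majority_preimage Ha _ _ _ _).2 Ug /(contra_not (majority_preimage Ha _ _ _ _).1) Uh.
  have [p xpy op] := cross x y g h xg yh Ug Uh; exists p => //.
  by apply: le_trans op _; rewrite le_max lexx orbT.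
move=> Ug Uh; have [p xpy op] := IH k' x y g h k'l xg yh Ug Uh; exists p => //.
by apply: le_trans op _; rewrite le_max lexx.
Qed.

Lemma geometric_hyperbolic : gromov_hyperbolic (@mdist R X).
Proof.
have [U [cU U0 nU0]] := exists_clopen Ha.
have [C [C0 orb]] := orbit_cobounded.
have [r noret] := no_return C C cU.
have [l [r' [lr lU]]] := far_cover r cU U0 nU0.
have [r'' cross] := finite_crossing C l cU.
pose D := 2 * C + `|r'| + `|r''|.
have D0 : 0 <= D by rewrite !addr_ge0 // mulr_ge0.
apply: (thin_hyperbolic (geometric_geodesic Hb) D0) => x y z p xpz.
(* Thinness at [p] is invariant under translation, and cocompactness brings [p] within [C] of
   [o]. *)
wlog op : x y z p xpz / mdist o p <= C.
  move=> W; have [g pg] := orb p.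
  have [|q [bq pq]] := W _ (b g^-1%g y) _ _ (between_translate g^-1%g xpz).
    rewrite metric_sym -(geometric_isometric Hb g) -bM mulgV b1.
    exact: pg.
  exists (b g q); split; last first.
    by rewrite -(geometric_isometric Hb g^-1%g) -bM mulVg b1.
  case: bq => /(between_translate g); rewrite -!bM !mulgV !b1; by [left|right].
have [g xg] := orb x; have [h zh] := orb z; have [f yf] := orb y.
have ler' := ler_norm r'; have ler'' := ler_norm r''.
have nr' : 0 <= `|r'| by []; have nr'' : 0 <= `|r''| by [].
have [gr'|gr'] := leP (mdist o (b g o)) r'.
  exists x; split; first by left; exact: betweenxx.
  have := metric_triangle p o x; have := metric_triangle o (b g o) x.
  rewrite (metric_sym p o) (metric_sym (b g o) x).
  by move: xg; rewrite /near_orbit /D; lra.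
(* [k] is far away and off the [U]-side while [k * g] is on it. A change of side from [x] to [y] or
   from [y] to [z] gives a point near [o]; without one, the geodesic from [x] to [z] contradicts
   [no_return]. *)
have [k kl Ukg] := lU g gr'; have [kr Uk] := lr k kl.
have fin q : mdist o q <= r'' -> mdist p q <= D.
  by have := metric_triangle p o q; rewrite (metric_sym p o) /D; lra.
have [Ukf|Ukf] := pselect (side U (k * f)%g); last first.
  by have [q bq oq] := cross k x y g f kl xg yf Ukg Ukf; exists q; split; [left|exact: fin].
have [Ukh|Ukh] := pselect (side U (k * h)%g); last first.
  by have [q bq oq] := cross k y z f h kl yf zh Ukf Ukh; exists q; split; [right|exact: fin].
have := noret x z p g h k xg zh xpz op Ukg Ukh Uk.
by rewrite leNgt kr.
Qed.

End GeometricAction.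

(** * The boundary *)

Section ShrinkingBasis.
Variables (G : topologicalGroupType) (M : topologicalType) (a : G -> M -> M).
Hypothesis Ha : sharp_setting a.

(** By compactness finitely many preimages suffice to exclude all points outside an open part of
    [N]; nestedness then gives one index. *)
Lemma shrinking_basis (U : set M) (u : nat -> G) x (N : set M) : clopen U ->
  (forall n, a (u n.+1) @^-1` U `<=` a (u n) @^-1` U) ->
  (forall y, y <> x -> exists n, ~ U (a (u n) y)) -> nbhs x N ->
  exists n, forall i, (n <= i)%N -> a (u i) @^-1` U `<=` N.
Proof.
move=> cU uS ux; rewrite nbhsE => -[V [oV Vx] VN].
have umono i j : (i <= j)%N -> a (u j) @^-1` U `<=` a (u i) @^-1` U.
  move=> /subnK <-; elim: (j - i)%N => // n IH; rewrite addSn.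
  exact: subset_trans (uS _) IH.
have /choice[n nP] : forall y, exists n, ~ V y -> ~ U (a (u n) y).
  move=> y; have [Vy|nVy] := pselect (V y); first by exists 0%N.
  by have [|n nU] := ux y; [move=> yx; apply: nVy; rewrite yx|exists n].
have [||l [_ lV]] := @compact_finite_cover _ (~` V)
    (fun y => a (u (n y)) @^-1` (~` U)).
- by apply: (subclosed_compact _ (sharp_compact Ha)) => //; exact: open_closedC.
- move=> y /nP nU; apply: open_nbhs_nbhs; split=> //.
  by have [] := clopen_translate Ha (u (n y)) (clopenC U cU).
exists (\max_(y <- l) n y)%N => i li y Uy; apply: VN; apply: contrapT => nVy.
have [z zl] := lV y nVy; apply; apply: umono Uy; apply: leq_trans li.
by rewrite (big_rem z) //= leq_maxl.
Qed.

End ShrinkingBasis.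

Lemma gromov_product_base (R : realType) (X : metricType R) (o o' p q : X) :
  gromov_product mdist o' p q <= gromov_product mdist o p q + mdist o o'.
Proof.
rewrite /gromov_product; have := metric_triangle o' o p.
have := metric_triangle o' o q; rewrite (metric_sym o' o); lra.
Qed.

Section Boundary.
Variables (R : realType) (G : topologicalGroupType) (X : metricType R).
Variables (b : G -> X -> X) (o : X).
Hypothesis Hb : geometric_setting b.
Implicit Types (g h k : G) (p q : X) (B : set G) (r C : R) (x y : nat -> X).
Variables (M : topologicalType) (a : G -> M -> M).
Hypothesis Ha : sharp_setting a.
Variable (t : M * M * M).
Hypothesis Dt : pairwise_distinct t.
Implicit Types (U : set M) (m : M).

Local Notation side U g := (majority U (diag3 a g t)).
Local Notation near_base := (near_orbit b o).

(** A geodesic with ends on opposite sides meets a fixed ball at [o], and the Gromov product is at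
    most the distance from [o] to that geodesic. *)
Lemma large_product_side C U : clopen U -> exists r, forall p q g h,
  near_base C p g -> near_base C q h -> r < gromov_product mdist o p q ->
  side U g -> side U h.
Proof.
move=> cU; have [r cross] := crossing o Hb Ha Dt C cU.
exists r => p q g h pg qh rpq Ug; apply: contrapT => Uh.
have [s + os] := cross p q g h pg qh Ug Uh; rewrite /between.
have := metric_triangle o s p; have := metric_triangle o s q.
rewrite (metric_sym s p); move: rpq; rewrite /gromov_product; lra.
Qed.

(** The point [s] at distance [(o|q)_p] from [p] satisfies [(p|s)_o = (s|q)_o = ((p|q)_o + d(o,s)) /
    2], so hyperbolicity bounds [d(o,s)], with twice its constant as error. *)
Lemma geodesic_near_base : exists D : R, forall p q, exists s,
  between p s q /\ mdist o s <= gromov_product mdist o p q + D.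
Proof.
have [D D0 hyp] := geometric_hyperbolic o Hb Ha Dt.
exists (2 * D) => p q.
have [|s psq ps] := interpolate (geometric_geodesic Hb) (x := p) (y := q)
    (s := gromov_product mdist p o q).
  have := metric_triangle o p q; have := metric_triangle p o q.
  have := metric_triangle p q o.
  rewrite /gromov_product (metric_sym q o) (metric_sym p o).
  by move=> ? ? ?; apply/andP; split; lra.
exists s; split=> //; have := hyp o p s q.
rewrite lerBlDr ge_min => /orP[]; move: psq ps;
  rewrite /between /gromov_product (metric_sym p o); lra.
Qed.

(** If the Gromov product were small, a geodesic from [p] to [q] would pass near [o], and
    [no_return] would bound the displacement of [k]. *)
Lemma same_side_large_product C r U : clopen U -> exists r', forall p q g h k,
  near_base C p g -> near_base C q h -> side U (k * g)%g -> side U (k * h)%g ->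
  ~ side U k -> r' < mdist o (b k o) -> r < gromov_product mdist o p q.
Proof.
move=> cU; have [D DP] := geodesic_near_base.
have [r' noret] := no_return o Hb Ha Dt C (r + D) cU.
exists r' => p q g h k pg qh Ukg Ukh Uk; apply: contraTT; rewrite -!leNgt => pqr.
have [s [psq os]] := DP p q.
by apply: (noret p q s g h k) => //; lra.
Qed.

(** Quantifying over all [C] makes the notion independent of the choice of nearby orbit points. *)
Definition eventually_side U x := forall C,
  \forall n \near \oo, forall g, near_base C (x n) g -> side U g.

(** This is convergence of a sequence of [X] to a point of [M]: for [g] near the sequence, two
    entries of [g.t] are close to [m]. *)
Definition tends x m := forall U, clopen U -> U m -> eventually_side U x.

(** Two majorities among three positions share an entry, whose image lies in both sets. *)
Lemma eventually_sideI U U' x :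
  eventually_side U x -> eventually_side U' x -> U `&` U' !=set0.
Proof.
have [C [_ orb]] := orbit_cobounded o Hb.
move=> /(_ C) xU /(_ C) xU'.
have [n [xUn xU'n]] := filter_ex (filterI xU xU').
have [g xg] := orb (x n); have := xU'n g xg; have := xUn g xg.
rewrite !majority_diag3 => -[p tp [Up1 Up2]] [q tq [Uq1 Uq2]].
move: tp tq; rewrite !inE => /or3P[] /eqP ep /or3P[] /eqP eq;
  rewrite ep eq /= in Up1 Up2 Uq1 Uq2 *;
  by [exists (a g t.1.1)|exists (a g t.1.2)|exists (a g t.2)].
Qed.

Lemma tends_unique x m m' : tends x m -> tends x m' -> m = m'.
Proof.
move=> xm xm'; apply: contrapT => /(clopen_separate Ha)[U [cU Um nUm']].
have [z [Uz]] := eventually_sideI (xm U cU Um) (xm' (~` U) (clopenC U cU) nUm').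
exact.
Qed.

Lemma gromov_converge_near x y r : gromov_converge x y ->
  exists n, forall i j, (n <= i)%N -> (n <= j)%N ->
    r < gromov_product mdist o (x i) (y j).
Proof.
move=> /(_ o) /cvgryPgt /(_ r) [[A B] /= [[i _ iA] [j _ jB]] AB].
exists (maxn i j) => i' j'; rewrite !geq_max => /andP[ii' ji'] /andP[ij' jj'].
by apply: (AB (i', j')); split; [exact: iA|exact: jB].
Qed.

(** Gromov products of late terms are large, so one late term on the [U]-side forces all others to
    that side. *)
Lemma frequently_side C0 x U : gromov_sequence x -> clopen U ->
  (forall n, exists i g, [/\ (n <= i)%N, near_base C0 (x i) g & side U g]) ->
  eventually_side U x.
Proof.
move=> gx cU freq C.
have [r rP] := large_product_side (Num.max C C0) cU.
have [n nP] := gromov_converge_near r gx.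
have [i [g [ni xg Ug]]] := freq n.
exists n => // j nj h xh; apply: (rP (x i) (x j) g h) => //; last exact: nP.
  by apply: le_trans xg _; rewrite le_max lexx orbT.
by apply: le_trans xh _; rewrite le_max lexx.
Qed.

Lemma gromov_sequence_side x U : gromov_sequence x -> clopen U ->
  eventually_side U x \/ eventually_side (~` U) x.
Proof.
move=> gx cU; have [C [_ orb]] := orbit_cobounded o Hb.
have [freq|] := pselect (forall n, exists i g,
    [/\ (n <= i)%N, near_base C (x i) g & side U g]).
  by left; exact: frequently_side freq.
move=> /existsNP[n nfreq]; right.
apply: (@frequently_side C) => //; first exact: clopenC.
move=> n'; have [g xg] := orb (x (maxn n n')).
exists (maxn n n'), g; split=> //; first exact: leq_maxr.
apply/majorityC => Ug; apply: nfreq; exists (maxn n n'), g; split=> //.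
exact: leq_maxl.
Qed.

(** Otherwise each point of [M] has a clopen neighbourhood that [x] eventually avoids. By
    [majority_cover] late terms would be bounded, whereas [(x_i|x_i)_o] is the distance from [o] to
    [x_i] and tends to infinity. *)
Lemma gromov_sequence_tends x : gromov_sequence x -> exists m, tends x m.
Proof.
move=> gx; have [C [_ orb]] := orbit_cobounded o Hb.
apply: contrapT => nx.
have /choice[U UP] : forall m, exists U,
    [/\ clopen U, U m & eventually_side (~` U) x].
  move=> m; apply: contrapT => nU; apply: nx; exists m => U cU Um.
  have [//|xnU] := gromov_sequence_side gx cU.
  by exfalso; apply: nU; exists U.
have [l] := majority_cover Ha Dt (U := U)
  (fun m => let: And3 cU _ _ := UP m in cU) (fun m => let: And3 _ Um _ := UP m in Um).
move=> /(relatively_compact_bounded o Hb)[r lr].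
have [n nP] := gromov_converge_near (r + C) gx.
have : \forall i \near \oo, forall m, m \in l -> forall g,
    near_base C (x i) g -> side (~` U m) g.
  elim: l {lr} => [|m l IH]; first by near=> i.
  have [_ _ /(_ C) mx] := UP m; near=> i => m'; rewrite inE => /predU1P[->|m'l].
    by near: i.
  by move: m' m'l; near: i.
move=> [n' _ n'P]; have := n'P _ (leq_maxr n n') => {}n'P.
have [g xg] := orb (x (maxn n n')).
have : mdist o (b g o) <= r.
  by apply: lr => m ml; apply/majorityC; exact: n'P ml _ xg.
have := nP _ _ (leq_maxl n n') (leq_maxl n n'); rewrite /gromov_product mdistxx.
have := metric_triangle o (b g o) (x (maxn n n')).
rewrite (metric_sym (b g o)); move: xg; rewrite /near_orbit; lra.
Unshelve. all: by end_near. Qed.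

(** [V] is the preimage of [U] under a far element [k] off the [U]-side; sequences eventually on the
    [V]-side fall under [same_side_large_product]. *)
Lemma tends_large_product m r : exists V : set M, [/\ clopen V, V m &
  forall m', V m' -> forall x y, tends x m -> tends y m' ->
    \forall i \near \oo & j \near \oo, r < gromov_product mdist o (x i) (y j)].
Proof.
have [U [cU U0 nU0]] := exists_clopen Ha.
have [C [_ orb]] := orbit_cobounded o Hb.
have [r' r'P] := same_side_large_product C r cU.
have [k [kr Ukm Uk _]] :=
  far_contracting o Hb Ha Dt r' cU U0 nU0 (@filterT _ (nbhs m) _).
have cV := clopen_translate Ha k cU.
exists (a k @^-1` U); split=> // m' Vm' x y xm ym'.
have xV := xm _ cV Ukm C; have yV := ym' _ cV Vm' C.
exists ([set i | forall g, near_base C (x i) g -> side (a k @^-1` U) g],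
        [set j | forall g, near_base C (y j) g -> side (a k @^-1` U) g]) => //.
move=> [i j] /= [xi yj]; have [g xg] := orb (x i); have [h yh] := orb (y j).
apply: (r'P _ _ g h k) => //; apply: (majority_preimage Ha _ _ _ _).1.
  exact: xi.
exact: yj.
Qed.

Lemma tends_converge x y m : tends x m -> tends y m -> gromov_converge x y.
Proof.
move=> xm ym o'; apply/cvgryPge => r.
have [V [_ Vm VP]] := tends_large_product m (r + mdist o' o).
have := VP m Vm x y xm ym; apply: filterS => ij /=.
by have := gromov_product_base o' o (x ij.1) (y ij.2); lra.
Qed.

Lemma converge_tends x y m : tends x m -> gromov_converge x y -> tends y m.
Proof.
move=> xm xy U cU Um C; have [C0 [_ orb]] := orbit_cobounded o Hb.
have [r rP] := large_product_side (Num.max C C0) cU.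
have [n nP] := gromov_converge_near r xy.
have [n' _ n'P] := xm U cU Um C0.
have [g xg] := orb (x (maxn n n')).
exists n => // j nj h yh; apply: (rP (x (maxn n n')) (y j) g h).
- by apply: le_trans xg _; rewrite le_max lexx orbT.
- by apply: le_trans yh _; rewrite le_max lexx.
- by apply: nP => //; exact: leq_maxl.
- by apply: n'P xg; exact: leq_maxr.
Qed.

(** For [u] shrinking to [t.1.1], the inverse of [u n] sends [t.1.1] and [t.1.2], both in [U], into
    ever smaller neighbourhoods of [t.1.1]; [g^-1] moves these to [m]. *)
Lemma exists_tends m : exists x, tends x m.
Proof.
have [z zt] := exists_notin Ha (triple_points t).
have [D [cD Dz nD]] := clopen_notin Ha zt; pose U := ~` D.
have cU : clopen U by exact: clopenC.
have U0 : U !=set0 by exists t.1.1; apply: nD; rewrite !inE eqxx.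
have nU0 : ~` U !=set0 by exists z; rewrite /U setCK.
have [y my] := exists_notin Ha [:: m].
have [g [gm _]] : exists g, a g m = t.1.1 /\ a g y = t.1.2.
  apply: (pair_transitive Ha); first by move: my; rewrite inE => /eqP /nesym.
  by case: Dt.
have Ut1 : U t.1.1 by apply: nD; rewrite !inE eqxx.
have Ut2 : U t.1.2 by apply: nD; rewrite !inE eqxx orbT.
have [l [lS lU]] := exists_shrinks Ha cU U0 nU0.
have [u [_ _ uU uB uy]] := shrinking_sequence Ha cU nU0 lS lU Ut1.
exists (fun n => b (g^-1 * (u n)^-1)%g o) => U' cU' U'm C.
have nU'' : nbhs t.1.1 (a g^-1%g @^-1` U').
  apply: open_nbhs_nbhs; split; last by rewrite /= -gm (actK Ha).
  by have [] := clopen_translate Ha g^-1%g cU'.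
have [n1 n1P] := shrinking_basis Ha cU (fun n => (uU n).2) uy nU''.
(* An [h] near the sequence but off the [U']-side would put [(u n * g)^-1] in a relatively compact
   set, which [u] eventually rules out. *)
have cS := majority_boundary Ha cU' Dt (bounded_relatively_compact o Hb C).
have /uB[n2 n2P] := relatively_compact_preimageMr g
  (relatively_compact_preimageV cS).
exists (maxn n1 n2) => // n /=; rewrite geq_max => /andP[n1n n2n] h xh.
have Uv : side U' (g^-1 * (u n)^-1)%g.
  apply/majority_diag3; exists (t.1.1, t.1.2); first by rewrite inE eqxx.
  by rewrite /= !(actM Ha); split; apply: (n1P n n1n); rewrite /= (actVK Ha).
apply: contrapT => Uh; apply: (n2P n n2n) => /=.
rewrite invgM; exists ((g^-1 * (u n)^-1)^-1 * h)%g; last by rewrite mulVKg.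
rewrite /= -(geometric_isometric Hb (g^-1 * (u n)^-1)%g).
case: (geometric_action Hb) => -[_ bM _].
by rewrite -bM mulVKg.
Qed.

Lemma tends_translate x m g : tends x m -> tends (b g \o x) (a g m).
Proof.
move=> xm U cU Um C; have := xm _ (clopen_translate Ha g cU) Um C.
apply: filterS => n nP h xh.
rewrite -(mulVKg g h); apply/(majority_preimage Ha); apply: nP.
move: xh; rewrite /near_orbit -(geometric_isometric Hb g^-1%g).
case: (geometric_action Hb) => -[b1 bM _].
by rewrite /= -bM mulVg b1 bM.
Qed.

Lemma boundary_ext (p q : gromov_boundary X) :
  boundary_class p = boundary_class q -> p = q.
Proof.
case: p q => [A PA] [B PB] /= AB; case: _ / AB in PB *.
by congr GromovBoundary; exact: Prop_irrelevance.
Qed.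

Lemma tends_class m : exists2 x, gromov_sequence x &
  [set x | tends x m] = gromov_class x.
Proof.
have [x xm] := exists_tends m; exists x; first exact: (tends_converge xm xm).
apply/seteqP; split=> [y ym|y [_ xy]]; last exact: (converge_tends xm xy).
by split; [exact: (tends_converge ym ym)|exact: (tends_converge xm ym)].
Qed.

Lemma boundary_tends (p : gromov_boundary X) :
  exists m, forall x, boundary_class p x -> tends x m.
Proof.
have [x gx ->] := boundary_classP p.
have [m xm] := gromov_sequence_tends gx; exists m => y [_ xy].
exact: (converge_tends xm xy).
Qed.

Lemma boundary_homeomorphic : equivariantly_homeomorphic_to_boundary a b.
Proof.
(* The boundary point attached to [m] is the set of all sequences tending to [m], which is a single
   Gromov class. *)
pose f m := GromovBoundary (tends_class m).
have /choice[f' f'P] := boundary_tends.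
have fP m x : boundary_class (f m) x = tends x m by [].
have f'f m : f' (f m) = m.
  have [x xm] := exists_tends m; apply: (@tends_unique x) => //.
  exact: f'P.
have ff' (p : gromov_boundary X) : f (f' p) = p.
  apply: boundary_ext; have [x gx px] := boundary_classP p.
  have xp : boundary_class p x by rewrite px; split.
  apply/seteqP; split=> [y|y /f'P//]; rewrite fP => yp.
  by rewrite px; split; [exact: (tends_converge yp yp)|exact: (tends_converge (f'P p x xp) yp)].
exists f, f'; split=> //.
- apply/continuousP => A oA; rewrite openE => m /= Afm.
  have [r rA] := oA (f m) Afm o.
  have [V [[oV _] Vm VP]] := tends_large_product m r.
  rewrite /interior nbhsE; exists V => // m' Vm'; apply: rA.
  have [x xm] := exists_tends m; have [y ym'] := exists_tends m'.
  exists x, y; split=> //; have := VP m' Vm' x y xm ym'.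
  by apply: filterS => ij /ltW.
- apply/continuousP => A oA.
  suff : boundary_open (f' @^-1` A) by [].
  move=> p /= Ap o'.
  have [U cU [Um UA]] := sharp_clopen_nbhs Ha (open_nbhs_nbhs (conj oA Ap)).
  have [C [_ orb]] := orbit_cobounded o Hb.
  have [r rP] := large_product_side C cU.
  (* The bound absorbs the change of base point, and the 1 makes the inequality strict. *)
  exists (r + mdist o o' + 1) => q [x [y [px qy xy]]]; apply: UA.
  apply: contrapT => nUq.
  have [i0 _ xU] := f'P p x px U cU Um C.
  have [j0 _ yU] := f'P q y qy (~` U) (clopenC U cU) nUq C.
  have [[P Q] /= [[i1 _ iP] [j1 _ jQ]] PQ] := xy.
  pose i := maxn i0 i1; pose j := maxn j0 j1.
  have [g xg] := orb (x i); have [h yh] := orb (y j).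
  have /majorityC : side (~` U) h by apply: yU yh; exact: leq_maxl.
  apply; apply: (rP _ _ _ _ xg yh); last by apply: xU xg; exact: leq_maxl.
  have := PQ (i, j) (conj (iP _ (leq_maxr _ _)) (jQ _ (leq_maxr _ _))) => /=.
  have := gromov_product_base o o' (x i) (y j); lra.
- move=> g m; apply/seteqP; split=> [y ygm|_ [x xm <-]]; last first.
    exact: tends_translate.
  case: (geometric_action Hb) => -[b1 bM _].
  exists (b g^-1%g \o y); last first.
    by apply/funext => n /=; rewrite -bM mulgV b1.
  by have := @tends_translate y _ g^-1%g ygm; rewrite (actK Ha).
Qed.

End Boundary.

(** * Metric graphs *)

(** Different vertices may be at distance 0, so that group elements can serve as vertices in place
    of cosets of a subgroup. *)
Record pseudometric_graph := PseudometricGraph {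
  graph_vertex :> Type ;
  graph_dist : graph_vertex -> graph_vertex -> nat ;
  graph_distxx : forall v, graph_dist v v = 0%N ;
  graph_distC : forall v w, graph_dist v w = graph_dist w v ;
  graph_dist_triangle : forall u v w,
    (graph_dist u w <= graph_dist u v + graph_dist v w)%N }.

Section MetricGraph.
Variables (R : realType) (V : pseudometric_graph).
Implicit Types (u v w : V) (s : R) (e : bool).

Local Notation d := (@graph_dist V).

Definition dist v w : R := (d v w)%:R.

Lemma dist_ge0 v w : 0 <= dist v w.
Proof. by rewrite ler0n. Qed.

Lemma distxx v : dist v v = 0.
Proof. by rewrite /dist graph_distxx. Qed.

Lemma distC v w : dist v w = dist w v.
Proof. by rewrite /dist graph_distC. Qed.

Lemma dist_triangle v u w : dist u w <= dist u v + dist v w.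
Proof. by rewrite -natrD ler_nat graph_dist_triangle. Qed.

Lemma dist0_l u v w : d u v = 0%N -> dist u w = dist v w.
Proof.
move=> uv; apply/eqP; rewrite eq_le; apply/andP; split.
  by have := dist_triangle v u w; rewrite {2}/dist uv add0r.
by have := dist_triangle u v w; rewrite (distC v u) {2}/dist uv add0r.
Qed.

Lemma dist0_r u v w : d u v = 0%N -> dist w u = dist w v.
Proof. by move=> uv; rewrite !(distC w); exact: dist0_l. Qed.

(* (v, w, s) stands for the point at distance s from v on the edge from v to w;
   s is truncated to the length of the edge, and the edge is replaced by the
   vertex v when v and w are not adjacent. *)
Definition position := (V * V * R)%type.
Implicit Types P Q T : position.

Definition tail P : V := if (d P.1.1 P.1.2 <= 1)%N then P.1.2 else P.1.1.
Definition endpoint P e : V := if e then P.1.1 else tail P.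
Definition edge_length P : R := dist (endpoint P true) (endpoint P false).
Definition offset P : R := Num.max 0 (Num.min P.2 (edge_length P)).
Definition arm P e : R := if e then offset P else edge_length P - offset P.
Definition cost P Q e e' : R :=
  arm P e + dist (endpoint P e) (endpoint Q e') + arm Q e'.
Definition parallel P Q := (d (endpoint P true) (endpoint Q true) == 0%N) &&
  (d (endpoint P false) (endpoint Q false) == 0%N).
Definition min_cost P Q : R :=
  Num.min (Num.min (cost P Q true true) (cost P Q true false))
          (Num.min (cost P Q false true) (cost P Q false false)).
(** On one edge the distance is measured along it; otherwise a path leaves through an endpoint. For
    [v], [w] at distance 1, the edges from [v] to [w] and from [w] to [v] are two segments glued at
    their ends. *)
Definition pdist P Q : R :=
  if parallel P Q then `|offset P - offset Q| else min_cost P Q.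

Lemma edge_length_le1 P : 0 <= edge_length P <= 1.
Proof.
rewrite dist_ge0 /edge_length /dist /= /tail.
by case: ifP => [le1|_]; rewrite ?graph_distxx ?ler01 // -[1]/(1%:R) ler_nat.
Qed.

Lemma offset_bounds P : 0 <= offset P <= edge_length P.
Proof.
have /andP[l0 _] := edge_length_le1 P.
by rewrite /offset le_max lexx ge_max l0 ge_min lexx orbT.
Qed.

Lemma offset_id P : 0 <= P.2 <= edge_length P -> offset P = P.2.
Proof. by move=> /andP[s0 sl]; rewrite /offset min_l // max_r. Qed.

Lemma arm_ge0 P e : 0 <= arm P e.
Proof.
by have /andP[s0 sl] := offset_bounds P; case: e; rewrite /arm // subr_ge0.
Qed.

Lemma parallelP P Q : parallel P Q -> forall e, d (endpoint P e) (endpoint Q e) = 0%N.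
Proof. by move=> /andP[/eqP ? /eqP ?] []. Qed.

Lemma parallelI P Q : (forall e, d (endpoint P e) (endpoint Q e) = 0%N) -> parallel P Q.
Proof. by move=> PQ; rewrite /parallel !PQ. Qed.

Lemma parallelxx P : parallel P P.
Proof. by apply: parallelI => e; rewrite graph_distxx. Qed.

Lemma parallel_sym P Q : parallel P Q = parallel Q P.
Proof. by rewrite /parallel !(graph_distC (endpoint P _)). Qed.

Lemma parallel_trans Q P T : parallel P Q -> parallel Q T -> parallel P T.
Proof.
move=> /parallelP PQ /parallelP QT; apply: parallelI => e.
by apply/eqP; rewrite -leqn0 (leq_trans (graph_dist_triangle _ (endpoint Q e) _)) // PQ QT.
Qed.

Lemma parallel_length P Q : parallel P Q -> edge_length P = edge_length Q.
Proof.
move=> /parallelP PQ; rewrite /edge_length (dist0_l _ (PQ true)).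
exact: dist0_r (PQ false).
Qed.

Lemma min_cost_le P Q e e' : min_cost P Q <= cost P Q e e'.
Proof. by rewrite /min_cost; case: e; case: e'; rewrite !ge_min lexx ?orbT. Qed.

Lemma min_cost_attained P Q : exists e e', min_cost P Q = cost P Q e e'.
Proof.
rewrite /min_cost; case: (leP (cost P Q true true)) => _;
  case: (leP (cost P Q false true)) => _; case: ltP => _;
  by [exists true, true|exists true, false|exists false, true|exists false, false].
Qed.

Lemma cost_sym P Q e e' : cost P Q e e' = cost Q P e' e.
Proof. by rewrite /cost (distC (endpoint P e)); lra. Qed.

Lemma pdist_sym P Q : pdist P Q = pdist Q P.
Proof.
rewrite /pdist parallel_sym distrC; case: ifP => // _.
by rewrite /min_cost !(cost_sym P Q) minACA.
Qed.

Lemma pdistxx P : pdist P P = 0.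
Proof. by rewrite /pdist parallelxx subrr normr0. Qed.

(** A route entering by one end of the edge of [Q] and leaving by the other crosses that edge, whose
    length is the sum of the two arms at [Q]. *)
Lemma cost_triangle P Q T e e1 e2 e' :
  cost P T e e' <= cost P Q e e1 + cost Q T e2 e'.
Proof.
rewrite /cost; have := dist_triangle (endpoint Q e1) (endpoint P e) (endpoint T e').
have := dist_triangle (endpoint Q e2) (endpoint Q e1) (endpoint T e').
suff : dist (endpoint Q e1) (endpoint Q e2) <= arm Q e1 + arm Q e2 by lra.
have a1 := arm_ge0 Q e1; have a2 := arm_ge0 Q e2.
have [<-|e12] := eqVneq e1 e2; first by rewrite distxx addr_ge0.
have -> : dist (endpoint Q e1) (endpoint Q e2) = edge_length Q.
  by case: e1 e2 e12 {a1 a2} => -[] // _; rewrite distC.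
by case: e1 e2 e12 {a1 a2} => -[] // _; rewrite /arm; lra.
Qed.

Lemma offset_dist_le_cost P T e e' : parallel P T ->
  `|offset P - offset T| <= cost P T e e'.
Proof.
move=> PT; have eT := parallel_length PT; have := parallelP PT => dPT.
have /andP[p0 pl] := offset_bounds P; have /andP[t0 tl] := offset_bounds T.
rewrite /cost (dist0_l _ (dPT e)) /arm eT; rewrite eT in pl.
have ge0 := dist_ge0 (endpoint T e) (endpoint T e').
have ends : dist (endpoint T false) (endpoint T true) = edge_length T.
  exact: distC.
rewrite ler_norml; apply/andP; move: ge0.
by case: e; case: e'; rewrite ?distxx ?ends -?/(edge_length T); split; lra.
Qed.

Lemma pdist_triangle Q P T : pdist P T <= pdist P Q + pdist Q T.
Proof.
(* Sliding [A] along its edge to [B] changes each arm by at most the difference of the offsets. *)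
have mixed A B C : parallel A B -> min_cost A C <= `|offset A - offset B| + min_cost B C.
  move=> AB; have [e [e' ->]] := min_cost_attained B C.
  apply: le_trans (min_cost_le A C e e') _; rewrite /cost.
  rewrite (dist0_l _ (parallelP AB e)) !addrA !lerD2r /arm (parallel_length AB).
  have := ler_norm (offset A - offset B); have := ler_norm (offset B - offset A).
  by rewrite (distrC (offset B)); case: (e); lra.
have min_sym A B : min_cost A B = min_cost B A.
  by rewrite /min_cost !(cost_sym A B) minACA.
rewrite /pdist; have [PQ|nPQ] := boolP (parallel P Q).
  have [QT|nQT] := boolP (parallel Q T).
    by rewrite (parallel_trans PQ QT); exact: ler_distD.
  rewrite ifN; first exact: mixed.
  apply: contra nQT; apply: parallel_trans; by rewrite parallel_sym.
have [QT|nQT] := boolP (parallel Q T).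
  rewrite ifN; last first.
    by apply: contra nPQ => PT; apply: parallel_trans PT _; rewrite parallel_sym.
  rewrite (min_sym P T) (min_sym P Q) addrC distrC; apply: mixed.
  by rewrite parallel_sym.
have [e [e1 ->]] := min_cost_attained P Q.
have [e2 [e' ->]] := min_cost_attained Q T.
apply: le_trans (cost_triangle P Q T e e1 e2 e').
by case: ifP => PT; [exact: offset_dist_le_cost|exact: min_cost_le].
Qed.

(** The metric quotient is realised by distance functions: positions at distance 0 have the same
    one, hence give equal points. *)
Record graph_point := GraphPoint {
  distance_from : position -> R ;
  graph_pointP : exists P, distance_from = pdist P }.

HB.instance Definition _ := gen_eqMixin graph_point.
HB.instance Definition _ := gen_choiceMixin graph_point.

Definition point_at P : graph_point := @GraphPoint (pdist P) (ex_intro _ P erefl).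
Definition representative (x : graph_point) : position := projT1 (cid (graph_pointP x)).

Lemma point_ext (x y : graph_point) : distance_from x = distance_from y -> x = y.
Proof.
case: x y => [f Pf] [g Pg] /= fg; case: _ / fg in Pg *.
by congr GraphPoint; exact: Prop_irrelevance.
Qed.

Lemma representativeK x : point_at (representative x) = x.
Proof. by apply: point_ext; rewrite /= /representative; case: cid => P /= ->. Qed.

Lemma point_at_eq P Q : pdist P Q = 0 -> point_at P = point_at Q.
Proof.
move=> PQ; apply: point_ext; apply/funext => T /=; apply/eqP; rewrite eq_le.
apply/andP; split.
  by have := pdist_triangle Q P T; rewrite PQ add0r.
by have := pdist_triangle P Q T; rewrite (pdist_sym Q P) PQ add0r.
Qed.

Definition graph_mdist x y := pdist (representative x) (representative y).

Lemma graph_mdist_point P Q : graph_mdist (point_at P) (point_at Q) = pdist P Q.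
Proof.
have rep A B : pdist (representative (point_at A)) B = pdist A B.
  by have /(congr1 (fun x => distance_from x B)) := representativeK (point_at A).
by rewrite /graph_mdist rep pdist_sym rep pdist_sym.
Qed.

Lemma graph_mdistxx x : graph_mdist x x = 0.
Proof. exact: pdistxx. Qed.

Lemma graph_mdist_positivity x y : graph_mdist x y = 0 -> x = y.
Proof. by move=> /point_at_eq; rewrite !representativeK. Qed.

Lemma graph_mdist_sym x y : graph_mdist x y = graph_mdist y x.
Proof. exact: pdist_sym. Qed.

Lemma graph_mdist_triangle y x z :
  graph_mdist x z <= graph_mdist x y + graph_mdist y z.
Proof. exact: pdist_triangle. Qed.

HB.instance Definition _ := isMetric.Build R graph_point
  graph_mdistxx graph_mdist_positivity graph_mdist_sym graph_mdist_triangle.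

Lemma mdist_point_at P Q : mdist (point_at P) (point_at Q) = pdist P Q.
Proof. exact: graph_mdist_point. Qed.

End MetricGraph.

Arguments point_at {R V} P.

(** * Geodesic segments *)

Section GeodesicSegments.
Variables (R : realType) (X : metricType R).
Implicit Types x y z : X.

Definition geodesic_curve x y (c : R -> X) :=
  [/\ c 0 = x, c (mdist x y) = y
    & forall s t, 0 <= s <= mdist x y -> 0 <= t <= mdist x y ->
        mdist (c s) (c t) = `|s - t|].

Definition geodesic_segment x y := exists c, geodesic_curve x y c.

Lemma geodesic_curve_dist x y c s : geodesic_curve x y c ->
  0 <= s <= mdist x y -> mdist x (c s) = s /\ mdist (c s) y = mdist x y - s.
Proof.
move=> [cx cy cst] /[dup] sxy /andP[s0 s1].
have l0 := mdist_ge0 x y; split.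
  have := cst 0 s; rewrite cx lexx l0 => -> //.
  by rewrite sub0r normrN ger0_norm.
have := cst s (mdist x y); rewrite cy lexx l0 => -> //.
by rewrite distrC ger0_norm // subr_ge0.
Qed.

Lemma geodesic_segmentxx x : geodesic_segment x x.
Proof.
exists (fun=> x); split=> // s t; rewrite !mdistxx => s0 t0.
have -> : s = 0 by apply: le_anti; rewrite andbC.
by have -> : t = 0; [apply: le_anti; rewrite andbC|rewrite subr0 normr0].
Qed.

Lemma geodesic_segment_sym x y : geodesic_segment x y -> geodesic_segment y x.
Proof.
move=> [c [cx cy cst]]; exists (fun s => c (mdist x y - s)).
rewrite /geodesic_curve (metric_sym y x) subr0 subrr; split=> // s t.
move=> /andP[s0 s1] /andP[t0 t1].
rewrite cst; last 2 first.
  by apply/andP; split; lra.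
  by apply/andP; split; lra.
by rewrite distrC; congr (`|_|); lra.
Qed.

Lemma geodesic_segment_concat x y z : between x y z ->
  geodesic_segment x y -> geodesic_segment y z -> geodesic_segment x z.
Proof.
rewrite /between => xyz [c Hc] [c' Hc'].
have [cx cy cst] := Hc; have [cy' cz' cst'] := Hc'.
have lx := mdist_ge0 x y; have ly := mdist_ge0 y z.
pose e s := if s <= mdist x y then c s else c' (s - mdist x y).
have exy s : mdist x y <= s -> e s = c' (s - mdist x y).
  rewrite le_eqVlt /e => /predU1P[<-|xs]; first by rewrite lexx subrr cy' cy.
  by rewrite leNgt xs.
have e0 s : s <= mdist x y -> e s = c s by rewrite /e => ->.
have ez : e (mdist x z) = z.
  rewrite exy; last by rewrite -xyz lerDl.
  by rewrite -xyz addrAC subrr add0r.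
(* Across the junction [y] the triangle inequality gives the upper bound, and [y] being between [x]
   and [z] gives the lower one. *)
have mixed s t : 0 <= s <= mdist x y -> mdist x y <= t <= mdist x z ->
    mdist (e s) (e t) = t - s.
  move=> /[dup] sxy /andP[s0 s1] /andP[t0 t1].
  have tyz : 0 <= t - mdist x y <= mdist y z by apply/andP; split; lra.
  have [d1 d2] := geodesic_curve_dist Hc sxy.
  have [d3 d4] := geodesic_curve_dist Hc' tyz.
  rewrite (e0 s) // (exy t) //.
  have := metric_triangle (c s) y (c' (t - mdist x y)).
  have := metric_triangle x (c s) z.
  have := metric_triangle (c s) (c' (t - mdist x y)) z; lra.
exists e; split=> //; first by rewrite e0.
move=> s t /andP[s0 s1] /andP[t0 t1].
have [sy|sy] := leP s (mdist x y); have [ty|ty] := leP t (mdist x y).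
- by rewrite !e0 // cst // ?s0 ?t0.
- rewrite mixed ?s0 ?sy ?t1 ?ltW // distrC ger0_norm //; lra.
- by rewrite metric_sym mixed ?t0 ?ty ?s1 ?ltW // ger0_norm //; lra.
- rewrite !exy ?ltW // cst'; last 2 first.
    by apply/andP; split; lra.
    by apply/andP; split; lra.
  by congr (`|_|); lra.
Qed.

End GeodesicSegments.

Section GraphGeodesics.
Variables (R : realType) (V : pseudometric_graph).
Implicit Types (u v w : V) (P Q : position R V) (e : bool).

Local Notation d := (@graph_dist V).
Local Notation dist := (dist R).
Local Notation point_at := (@point_at R V).

Definition vertex v : graph_point R V := point_at (v, v, 0).

Lemma tail_vertex v (s : R) : tail (v, v, s) = v.
Proof. by rewrite /tail graph_distxx. Qed.

Lemma edge_length_vertex v (s : R) : edge_length (v, v, s) = 0.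
Proof. by rewrite /edge_length /= tail_vertex distxx. Qed.

Lemma offset_vertex v (s : R) : offset (v, v, s) = 0.
Proof.
have := offset_bounds (v, v, s : R); rewrite edge_length_vertex => /andP[? ?].
by apply: le_anti; apply/andP.
Qed.

Lemma endpoint_vertex v (s : R) e : endpoint (v, v, s) e = v.
Proof. by case: e; rewrite //= tail_vertex. Qed.

Lemma arm_vertex v (s : R) e : arm (v, v, s) e = 0.
Proof. by rewrite /arm offset_vertex edge_length_vertex subrr if_same. Qed.

Lemma mdist_vertex v w : mdist (vertex v) (vertex w) = dist v w.
Proof.
rewrite mdist_point_at /pdist /parallel !endpoint_vertex !offset_vertex andbb.
case: eqP => [vw|_]; first by rewrite subrr normr0 /dist vw.
have [e [e' ->]] := min_cost_attained (v, v, 0 : R) (w, w, 0).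
by rewrite /cost !arm_vertex !endpoint_vertex add0r addr0.
Qed.

Lemma mdist_endpoint P e : mdist (point_at P) (vertex (endpoint P e)) <= arm P e.
Proof.
rewrite mdist_point_at /pdist; case: ifP => [PQ|_]; last first.
  apply: le_trans (min_cost_le _ _ e true) _.
  by rewrite /cost endpoint_vertex arm_vertex distxx !addr0.
rewrite offset_vertex subr0; have := parallel_length PQ.
rewrite edge_length_vertex => l0; have /andP[] := offset_bounds P; rewrite l0.
by move=> ? ?; have := arm_ge0 P e; rewrite ger0_norm //; lra.
Qed.

Lemma mdist_endpoint_le1 P e : mdist (point_at P) (vertex (endpoint P e)) <= 1.
Proof.
apply: le_trans (mdist_endpoint P e) _.
have /andP[? ?] := offset_bounds P; have /andP[? ?] := edge_length_le1 P.
by case: e; rewrite /arm; lra.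
Qed.

Lemma endpoint_adjacent P :
  (d (endpoint P true) (endpoint P false) <= 1)%N.
Proof. by rewrite /= /tail; case: ifP => // _; rewrite graph_distxx. Qed.

Lemma endpoint_edge P (s : R) e :
  endpoint (endpoint P true, endpoint P false, s) e = endpoint P e.
Proof. by case: e => //; rewrite {1}/endpoint {1}/tail endpoint_adjacent. Qed.

Lemma edge_length_edge P (s : R) :
  edge_length (endpoint P true, endpoint P false, s) = edge_length P.
Proof. by rewrite /edge_length !endpoint_edge. Qed.

Lemma offset_edge P (s : R) : 0 <= s <= edge_length P ->
  offset (endpoint P true, endpoint P false, s) = s.
Proof. by move=> sP; rewrite offset_id // edge_length_edge. Qed.

Lemma mdist_edge P (s t : R) :
  0 <= s <= edge_length P -> 0 <= t <= edge_length P ->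
  mdist (point_at (endpoint P true, endpoint P false, s))
        (point_at (endpoint P true, endpoint P false, t)) = `|s - t|.
Proof.
move=> sP tP; rewrite mdist_point_at /pdist parallelI ?offset_edge // => e.
by rewrite !endpoint_edge graph_distxx.
Qed.

Lemma edge_geodesic P (s t : R) :
  0 <= s <= edge_length P -> 0 <= t <= edge_length P ->
  geodesic_segment (point_at (endpoint P true, endpoint P false, s))
                   (point_at (endpoint P true, endpoint P false, t)).
Proof.
wlog st : s t / s <= t.
  move=> W s0 t0; have [st|/ltW ts] := leP s t; first exact: W.
  by apply: geodesic_segment_sym; exact: W.
move=> sP tP; rewrite /geodesic_segment /geodesic_curve mdist_edge //.
exists (fun r => point_at (endpoint P true, endpoint P false, s + r)).
have -> : `|s - t| = t - s by rewrite distrC ger0_norm ?subr_ge0.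
move: sP tP => /andP[s0 s1] /andP[t0 t1].
split; [by rewrite addr0|by rewrite addrC subrK|].
move=> r r' /andP[r0 r1] /andP[r0' r1'].
rewrite mdist_edge; [|by apply/andP; split; lra|by apply/andP; split; lra].
by congr (`|_|); lra.
Qed.

Lemma point_at_edge P :
  point_at (endpoint P true, endpoint P false, offset P) = point_at P.
Proof.
have lP : 0 <= offset P <= edge_length P by exact: offset_bounds.
apply: point_at_eq; rewrite /pdist parallelI; last first.
  by move=> e; rewrite endpoint_edge graph_distxx.
by rewrite offset_edge // subrr normr0.
Qed.

Lemma vertex_edge P e : vertex (endpoint P e) =
  point_at (endpoint P true, endpoint P false, if e then 0 else edge_length P).
Proof.
have /andP[l0 l1] := edge_length_le1 P.
apply: esym; apply: mdist_positivity.
apply: le_anti; rewrite mdist_ge0 andbT.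
have := mdist_endpoint (endpoint P true, endpoint P false,
  if e then 0 else edge_length P) e.
rewrite endpoint_edge; congr (_ <= _).
by rewrite /arm offset_edge ?edge_length_edge; case: (e); rewrite ?subrr ?lexx ?l0.
Qed.

Lemma endpoint_geodesic P e :
  geodesic_segment (point_at P) (vertex (endpoint P e)).
Proof.
rewrite vertex_edge -(point_at_edge P); apply: edge_geodesic.
  exact: offset_bounds.
by have /andP[l0 l1] := edge_length_le1 P; case: e; rewrite lexx ?l0.
Qed.

Lemma adjacent_geodesic P :
  geodesic_segment (vertex (endpoint P true)) (vertex (endpoint P false)).
Proof.
have /andP[l0 l1] := edge_length_le1 P.
by rewrite !vertex_edge; apply: edge_geodesic; rewrite lexx l0.
Qed.

Hypothesis interp : forall v w n, d v w = n.+1 ->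
  exists u, d v u = n /\ d u w = 1%N.

Lemma vertex_geodesic v w : geodesic_segment (vertex v) (vertex w).
Proof.
move en : (d v w) => n; elim: n w en => [|n IH] w vw.
  have -> : vertex w = vertex v; last exact: geodesic_segmentxx.
  by apply: mdist_positivity; rewrite mdist_vertex /dist graph_distC vw.
have [u [vu uw]] := interp vw.
apply: (@geodesic_segment_concat _ _ _ (vertex u)).
- by rewrite /between !mdist_vertex /dist vu uw vw -natrD addn1.
- exact: IH.
have := adjacent_geodesic (u, w, 0).
by rewrite /endpoint /tail /= uw.
Qed.

(** Two points of one edge are joined along it. Otherwise a cheapest route consists of an arm, a
    geodesic between vertices and an arm, whose lengths add up to the distance. *)
Lemma graph_geodesic : geodesic_metric (graph_point R V).
Proof.
move=> x y; rewrite -(representativeK x) -(representativeK y).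
move: (representative x) (representative y) => P Q {x y}.
have [PQ|nPQ] := boolP (parallel P Q).
  have eQ : point_at (endpoint P true, endpoint P false, offset Q) = point_at Q.
    have lQ : 0 <= offset Q <= edge_length P.
      by rewrite (parallel_length PQ); exact: offset_bounds.
    apply: point_at_eq; rewrite /pdist parallelI; last first.
      by move=> e; rewrite endpoint_edge; exact: parallelP.
    by rewrite offset_edge // subrr normr0.
  rewrite -eQ -(point_at_edge P); apply: edge_geodesic.
    exact: offset_bounds.
  by rewrite (parallel_length PQ); exact: offset_bounds.
have [e [e' E]] := min_cost_attained P Q.
have PQE : mdist (point_at P) (point_at Q) = cost P Q e e'.
  by rewrite mdist_point_at /pdist (negbTE nPQ).
have h1 := mdist_endpoint P e; have h2 := mdist_endpoint Q e'.
rewrite metric_sym in h2.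
have h3 := mdist_vertex (endpoint P e) (endpoint Q e').
rewrite /cost -h3 in PQE.
have t1 := metric_triangle (point_at P) (vertex (endpoint P e)) (point_at Q).
have t2 := metric_triangle (vertex (endpoint P e)) (vertex (endpoint Q e')) (point_at Q).
apply: (@geodesic_segment_concat _ _ _ (vertex (endpoint P e))).
- by rewrite /between; lra.
- exact: endpoint_geodesic.
apply: (@geodesic_segment_concat _ _ _ (vertex (endpoint Q e'))).
- by rewrite /between; lra.
- exact: vertex_geodesic.
by apply: geodesic_segment_sym; exact: endpoint_geodesic.
Qed.

End GraphGeodesics.

(** * The Cayley graph relative to a compact open subgroup *)

(** Invariance of [S] under [K] on both sides makes the word length descend to cosets of [K].
    Openness of [K] makes distances between vertices locally constant, and compactness of [K] and
    [S] makes balls compact. *)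
Record cayley_setting (G : topologicalGroupType) (K S : set G) : Prop :=
  CayleySetting {
    cayley_1 : K 1%g ;
    cayley_V : forall g, K g -> K g^-1%g ;
    cayley_M : forall g h, K g -> K h -> K (g * h)%g ;
    cayley_open : nbhs (1%g : G) K ;
    cayley_compact : compact K ;
    cayley_gens_compact : compact S ;
    cayley_gensV : forall g, S g -> S g^-1%g ;
    cayley_sub : K `<=` S ;
    cayley_gensMl : forall g h, K g -> S h -> S (g * h)%g ;
    cayley_gensMr : forall g h, S g -> K h -> S (g * h)%g ;
    cayley_generates : generates S }.

Section CayleyGraph.
Variables (R : realType) (G : topologicalGroupType) (K S : set G).
Hypothesis HS : cayley_setting K S.
Implicit Types (g h k : G) (n : nat).

(** The ball of radius 0 is [K] instead of the identity, so elements of one left coset are at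
    distance 0. *)
Fixpoint cayley_ball n : set G :=
  if n is n'.+1 then [set (g * s)%g | g in cayley_ball n' & s in S] else K.

Lemma cayley_ballM m n g h : cayley_ball m g -> cayley_ball n h ->
  cayley_ball (m + n) (g * h)%g.
Proof.
move=> mg; elim: n h => [|n IH] h /=.
  case: m mg => [|m] /=; first by move=> Kg Kh; exact: (cayley_M HS).
  move=> [g' mg' [s Ss <-]] Kh; rewrite addn0; exists g' => //.
  by exists (s * h)%g; [exact: (cayley_gensMr HS)|rewrite mulgA].
rewrite addnS => -[h' /IH nh' [s Ss <-]].
by exists (g * h')%g => //; exists s => //; rewrite mulgA.
Qed.

Lemma cayley_ball_gen g : S g -> cayley_ball 1 g.
Proof.
by move=> Sg; exists 1%g; [exact: (cayley_1 HS)|exists g; rewrite ?mul1g].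
Qed.

Lemma cayley_ballV n g : cayley_ball n g -> cayley_ball n g^-1%g.
Proof.
elim: n g => [|n IH] g; first exact: (cayley_V HS).
move=> [h /IH nh [s Ss <-]]; rewrite invgM.
exact: (cayley_ballM (cayley_ball_gen (cayley_gensV HS Ss)) nh).
Qed.

Lemma cayley_ball_sub m n : (m <= n)%N -> cayley_ball m `<=` cayley_ball n.
Proof.
move=> /subnK <-; elim: (n - m)%N => // p IH g /IH pg.
exists g => //; exists 1%g; last by rewrite mulg1.
exact: (cayley_sub HS) (cayley_1 HS).
Qed.

Lemma compact_cayley_ball n : compact (cayley_ball n).
Proof.
elim: n => [|n IH]; first exact: cayley_compact HS.
by apply: compact_mulg => //; exact: cayley_gens_compact HS.
Qed.

Lemma word_products_cayley n g : word_products S n g -> cayley_ball n g.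
Proof.
elim: n g => [|n IH] g /=; first by move=> ->; exact: cayley_1 HS.
move=> [h /IH nh [s Ss <-]]; exists h => //; exists s => //.
by case: Ss => // -[u /(cayley_gensV HS) Su <-].
Qed.

Lemma cayley_word_products n g : cayley_ball n.+1 g -> word_products S n.+1 g.
Proof.
elim: n g => [|n IH] g [h nh [s Ss <-]]; last first.
  by exists h; [exact: IH|exists s => //; left].
by apply: word_products1; exact: (cayley_gensMl HS).
Qed.

Lemma cayley_exhausts g : exists n, cayley_ball n g.
Proof.
have : [set: G] g by []; rewrite -(cayley_generates HS) => -[n _ ng].
by exists n; exact: word_products_cayley.
Qed.

Let exists_length g : exists n, `[< cayley_ball n g >].
Proof. by have [n ng] := cayley_exhausts g; exists n; apply/asboolP. Qed.

Definition cayley_length g : nat := ex_minn (exists_length g).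

Lemma cayley_lengthP g : cayley_ball (cayley_length g) g.
Proof. by rewrite /cayley_length; case: ex_minnP => n /asboolP. Qed.

Lemma cayley_length_le n g : cayley_ball n g <-> (cayley_length g <= n)%N.
Proof.
split=> [ng|/cayley_ball_sub]; last by apply; exact: cayley_lengthP.
by rewrite /cayley_length; case: ex_minnP => m _; apply; apply/asboolP.
Qed.

Lemma cayley_length_eq0 g : K g <-> cayley_length g = 0%N.
Proof.
by rewrite -[K g]/(cayley_ball 0 g) cayley_length_le leqn0; split=> /eqP.
Qed.

Definition cayley_dist g h := cayley_length (g^-1 * h)%g.

Lemma cayley_distxx g : cayley_dist g g = 0%N.
Proof. by apply/cayley_length_eq0; rewrite mulVg; exact: cayley_1 HS. Qed.

Lemma cayley_distC g h : cayley_dist g h = cayley_dist h g.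
Proof.
suff le g' h' : (cayley_dist g' h' <= cayley_dist h' g')%N.
  by apply/eqP; rewrite eqn_leq !le.
apply/cayley_length_le; rewrite -(invgK h') -invgM invgK.
exact/cayley_ballV/cayley_lengthP.
Qed.

Lemma cayley_dist_triangle h g k :
  (cayley_dist g k <= cayley_dist g h + cayley_dist h k)%N.
Proof.
apply/cayley_length_le; rewrite -(mulgK h g^-1%g) -mulgA.
by apply: cayley_ballM; exact: cayley_lengthP.
Qed.

Lemma cayley_dist_translate k g h : cayley_dist (k * g)%g (k * h)%g = cayley_dist g h.
Proof. by rewrite /cayley_dist invgM -mulgA mulKg. Qed.

Definition cayley_graph : pseudometric_graph :=
  PseudometricGraph cayley_distxx cayley_distC
    (fun g h k => cayley_dist_triangle h g k).

Lemma cayley_interpolate (g k : cayley_graph) n : graph_dist g k = n.+1 ->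
  exists h : cayley_graph, graph_dist g h = n /\ graph_dist h k = 1%N.
Proof.
rewrite /= /cayley_dist => gk; have := cayley_lengthP (g^-1 * k)%g.
rewrite gk => -[h nh [s Ss hs]]; exists (g * h)%g.
have l1 : (cayley_dist g (g * h)%g <= n)%N.
  by apply/cayley_length_le; rewrite mulKg.
have l2 : (cayley_dist (g * h)%g k <= 1)%N.
  apply/cayley_length_le; rewrite invgM -mulgA -hs mulKg.
  exact: cayley_ball_gen.
have := cayley_dist_triangle (g * h)%g g k; rewrite {1}/cayley_dist gk.
by move: l1 l2; rewrite /cayley_dist; lia.
Qed.

(** The two lengths agree outside [K]; on [K] the Cayley length is 0 and the word length at most
    1. *)
Lemma word_metric_cayley g h : (cayley_dist g h)%:R <= word_metric R S g h /\
  word_metric R S g h <= (cayley_dist g h)%:R + 1.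
Proof.
rewrite /word_metric /word_length /cayley_dist.
set w := (g^-1 * h)%g; set E := [set n%:R | n in _].
have lbE : lbound E (cayley_length w)%:R.
  move=> _ [n nw <-]; rewrite ler_nat; apply/cayley_length_le.
  exact: word_products_cayley.
have nE : E (maxn (cayley_length w) 1)%:R.
  exists (maxn (cayley_length w) 1) => //=.
  have /(cayley_ball_sub (leq_maxl _ 1)) := cayley_lengthP w.
  by case: (cayley_length w) => [|n]; rewrite ?maxnE //; exact: cayley_word_products.
split; first by apply: lb_le_inf => //; exists (maxn (cayley_length w) 1)%:R.
have -> : (cayley_length w)%:R + 1 = (cayley_length w + 1)%:R :> R by rewrite natrD.
apply: (@le_trans _ _ (maxn (cayley_length w) 1)%:R).
  by apply: ge_inf => //; exists (cayley_length w)%:R.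
by rewrite ler_nat geq_max leq_addr leq_addl.
Qed.

End CayleyGraph.

(** * The geometric action on the Cayley graph *)

Section CayleyAction.
Variables (R : realType) (G : topologicalGroupType) (K S : set G).
Hypothesis HS : cayley_setting K S.
Implicit Types (g h k : G) (n : nat).

Local Notation graph := (cayley_graph HS).
Local Notation X := (graph_point R graph).
Local Notation d := (cayley_dist HS).
Implicit Types (P Q : position R graph) (x y : X).

Definition translate_position (g : G) P : position R graph :=
  ((g * P.1.1)%g : graph, (g * P.1.2)%g : graph, P.2).

Lemma endpoint_translate g P e :
  endpoint (translate_position g P) e = (g * endpoint P e)%g.
Proof.
case: e => //; rewrite /endpoint /tail /= cayley_dist_translate.
by case: ifP.
Qed.

Lemma edge_length_translate g P : edge_length (translate_position g P) = edge_length P.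
Proof.
by rewrite /edge_length /dist !endpoint_translate /= cayley_dist_translate.
Qed.

Lemma offset_translate g P : offset (translate_position g P) = offset P.
Proof. by rewrite /offset edge_length_translate. Qed.

Lemma pdist_translate g P Q :
  pdist (translate_position g P) (translate_position g Q) = pdist P Q.
Proof.
have costE e e' : cost (translate_position g P) (translate_position g Q) e e' =
    cost P Q e e'.
  rewrite /cost /arm /dist !offset_translate !edge_length_translate.
  by rewrite !endpoint_translate /= cayley_dist_translate.
rewrite /pdist /min_cost !costE !offset_translate /parallel.
by rewrite !endpoint_translate /= !cayley_dist_translate.
Qed.

Definition cayley_action (g : G) (x : X) : X :=
  point_at (translate_position g (representative x)).

Lemma cayley_action_point g P :
  cayley_action g (point_at P) = point_at (translate_position g P).
Proof.
apply: point_at_eq; rewrite pdist_translate -mdist_point_at representativeK.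
exact: mdistxx.
Qed.

Lemma cayley_action_isometric g x y :
  mdist (cayley_action g x) (cayley_action g y) = mdist x y.
Proof.
rewrite -(representativeK x) -(representativeK y) !cayley_action_point.
by rewrite !mdist_point_at pdist_translate.
Qed.

Lemma cayley_group_action : group_action cayley_action.
Proof.
split=> [x|g h x]; rewrite -(representativeK x) !cayley_action_point.
  by case: (representative x) => -[v w] s; rewrite /translate_position /= !mul1g.
by case: (representative x) => -[v w] s; rewrite /translate_position /= !mulgA.
Qed.

Lemma near_cayley_dist0 g : \forall h \near g, d g h = 0%N.
Proof.
have := @mulg_continuousl G g^-1%g g K.
rewrite mulVg => /(_ (cayley_open HS)) nK.
apply: (@filterS _ _ _ [set h | K (g^-1 * h)%g] _ _ nK) => h Kh.
exact/cayley_length_eq0.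
Qed.

Lemma offset_lipschitz P Q : edge_length P = edge_length Q ->
  `|offset P - offset Q| <= `|P.2 - Q.2|.
Proof.
move=> PQ; rewrite /offset PQ; have /andP[] := edge_length_le1 Q.
move: (P.2) (Q.2) (edge_length Q) => s t l l0 _.
have := ler_norm (s - t); have := ler_norm (t - s); rewrite (distrC t s).
move=> st ts; rewrite ler_norml; case: (leP s l) => ?; case: (leP t l) => ?;
  case: (leP 0 s) => ?; case: (leP 0 t) => ?; case: (leP 0 l) => ?;
  apply/andP; split; lra.
Qed.

Lemma mdist_position_near (P Q : position R graph) :
  d P.1.1 Q.1.1 = 0%N -> d P.1.2 Q.1.2 = 0%N ->
  mdist (point_at P) (point_at Q) <= `|P.2 - Q.2|.
Proof.
move=> d1 d2; have PQ : parallel P Q.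
  apply: parallelI => -[//|]; rewrite /endpoint /tail.
  have -> : (graph_dist P.1.1 P.1.2 <= 1)%N = (graph_dist Q.1.1 Q.1.2 <= 1)%N.
    rewrite -!(ler_nat R); have := dist0_l R P.1.2 (d1 : graph_dist (_ : graph) _ = 0%N).
    by rewrite /dist => ->; have := dist0_r R Q.1.1 (d2 : graph_dist (_ : graph) _ = 0%N);
      rewrite /dist => ->.
  by case: ifP.
rewrite mdist_point_at /pdist PQ; apply: offset_lipschitz.
exact: parallel_length.
Qed.

Definition graph_chart (p : G * G * R) : X :=
  point_at ((p.1.1 : graph), (p.1.2 : graph), p.2).

Lemma graph_chart_continuous : continuous graph_chart.
Proof.
move=> [[v w] s]; apply/cvg_ballP => e e0.
have nv := near_cayley_dist0 v; have nw := near_cayley_dist0 w.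
have ns : \forall s' \near s, `|s - s'| < e by exact: (@nbhsx_ballx _ _ s e e0).
exists ([set vw | d v vw.1 = 0%N /\ d w vw.2 = 0%N], [set s' | `|s - s'| < e]).
  split=> //=; exists ([set v' | d v v' = 0%N], [set w' | d w w' = 0%N]) => //.
move=> [[v' w'] s'] /= [[dv dw] ss']; rewrite ballEmdist /=.
exact: le_lt_trans (mdist_position_near (P := (v, w, s)) (Q := (v', w', s')) dv dw) ss'.
Qed.

Lemma cayley_action_continuous : continuous_action cayley_action.
Proof.
split; first exact: cayley_group_action.
move=> [g x]; apply/cvg_ballP => e e0 /=.
pose P := representative x.
have n1 : \forall h \near g, d (g * P.1.1)%g (h * P.1.1)%g = 0%N.
  by have := @mulg_continuousr G P.1.1 g _ (near_cayley_dist0 (g * P.1.1)%g).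
have n2 : \forall h \near g, d (g * P.1.2)%g (h * P.1.2)%g = 0%N.
  by have := @mulg_continuousr G P.1.2 g _ (near_cayley_dist0 (g * P.1.2)%g).
have nx : \forall y \near x, ball x e y by exact: nbhsx_ballx.
exists ([set h | d (g * P.1.1)%g (h * P.1.1)%g = 0%N /\
                 d (g * P.1.2)%g (h * P.1.2)%g = 0%N], ball x e).
  by split=> //=; exact: filterI.
move=> [h y] /= [[d1 d2]]; rewrite !ballEmdist /= => xy.
apply: le_lt_trans xy; rewrite -(cayley_action_isometric h x y).
(* For [h] close to [g] the translated endpoints are at distance 0, so [g] and [h] act identically
   on [x]. *)
have -> : cayley_action g x = cayley_action h x; last by [].
apply: mdist_positivity; apply: le_anti; rewrite mdist_ge0 andbT.
have := mdist_position_near (P := translate_position g P)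
  (Q := translate_position h P) d1 d2.
by rewrite subrr normr0.
Qed.

Lemma mdist_vertex_cayley g h :
  mdist (vertex R (g : graph)) (vertex R (h : graph)) = (d g h)%:R.
Proof. exact: mdist_vertex. Qed.

Lemma cayley_action_vertex g h :
  cayley_action g (vertex R (h : graph)) = vertex R ((g * h)%g : graph).
Proof. by rewrite /vertex cayley_action_point. Qed.

Lemma near_vertex x : exists g : G, mdist x (vertex R (g : graph)) <= 1.
Proof.
exists (representative x).1.1; have := mdist_endpoint_le1 (representative x) true.
by rewrite representativeK.
Qed.

Local Notation o := (vertex R (1%g : graph)).

Lemma closed_mdist_le x (r : R) : closed [set y | mdist x y <= r].
Proof.
rewrite -openC openE => y /=; rewrite /setC /= => /negP; rewrite -ltNge => ry.
rewrite /interior; apply: filterS (nbhsx_ballx y (mdist x y - r) _); last first.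
  by rewrite subr_gt0.
move=> z; rewrite ballEmdist /= => yz; apply/negP; rewrite -ltNge.
by have := metric_triangle x z y; rewrite (metric_sym z y); lra.
Qed.

Lemma cayley_proper_metric : proper_metric X.
Proof.
move=> x r; have [g xg] := near_vertex x.
(* [g] is within 1 of [x] and the first endpoint within 1 of [y], hence [r + 2]; the other endpoint
   may be one further, hence the ball of radius [n.+1]. *)
have [n rn] := exists_natr_ge (r + 2).
pose B : set G := (fun h : G => (g * h)%g) @` cayley_ball K S n.+1.
have cB : compact B.
  exact: (continuous_compact (continuous_subspaceT (@mulg_continuousl G g))
    (@compact_cayley_ball _ _ _ HS n.+1)).
apply: (@subclosed_compact _ _ [set graph_chart p | p in B `*` B `*` `[0, 1]%classic]).
- exact: closed_mdist_le.
- apply: continuous_compact.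
    by apply: continuous_subspaceT; exact: graph_chart_continuous.
  by do 2?[apply: compact_setX] => //; exact: segment_compact.
move=> y /= xy; pose P := representative y.
have lP := offset_bounds P; have /andP[l0 l1] := edge_length_le1 P.
exists ((endpoint P true : G), (endpoint P false : G), offset P); last first.
  by rewrite /graph_chart /= (point_at_edge P) representativeK.
have BP m h : (d g h <= m)%N -> (m <= n.+1)%N -> B h.
  move=> gh mn; exists (g^-1 * h)%g; last by rewrite mulVKg.
  by apply/(cayley_length_le HS); exact: leq_trans gh mn.
have dg : (d g (endpoint P true) <= n)%N.
  rewrite -(ler_nat R) -mdist_vertex_cayley.
  have := mdist_endpoint_le1 P true; rewrite representativeK => yP.
  have := metric_triangle (vertex R (g : graph)) x (vertex R (endpoint P true)).
  have := metric_triangle x y (vertex R (endpoint P true)).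
  by rewrite (metric_sym _ x); lra.
split; last first.
  by rewrite /= in_itv /=; case/andP: lP => -> lP; exact: le_trans lP l1.
split; first exact: BP dg _.
apply: (BP n.+1) => //; apply: leq_trans (cayley_dist_triangle HS (endpoint P true) _ _) _.
by rewrite -addn1 leq_add //; exact: (endpoint_adjacent P).
Qed.

Lemma cayley_proper_action : proper_action cayley_action.
Proof.
move=> C cC; have [r rC] := compact_bounded_mdist o cC.
have [n rn] := exists_natr_ge (r + r).
(* The returning elements are the projection of a closed subset of a compact product: as [C] is
   within [r] of [o], they displace [o] by at most [r + r]. *)
have -> : [set g | cayley_action g @` C `&` C !=set0] =
    [set p.1 | p in [set p : G * X | (cayley_ball K S n `*` C) p /\
                                    C (cayley_action p.1 p.2)]].
  apply/seteqP; split=> [g [_ [[x Cx <-] Cgx]]|_ [[g x] /= [[_ Cx] Cgx] <-]].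
    exists (g, x) => //=; do 2?split=> //=; apply/(cayley_length_le HS).
    rewrite -(ler_nat R); have -> : cayley_length HS g = d 1%g g.
      by rewrite /cayley_dist invg1 mul1g.
    rewrite -mdist_vertex_cayley; have := rC _ Cx; have := rC _ Cgx.
    rewrite -(cayley_action_isometric g o x) cayley_action_vertex mulg1.
    have := metric_triangle o (cayley_action g x) (vertex R (g : graph)).
    rewrite (metric_sym (cayley_action g x)); lra.
  by exists (cayley_action g x); split=> //; exists x.
apply: continuous_compact.
  by apply: continuous_subspaceT; exact: fst_continuous.
apply: compact_closedI.
  by apply: compact_setX => //; exact: compact_cayley_ball.
apply: (closed_comp (f := fun p : G * X => cayley_action p.1 p.2) (D := C)).
  by move=> p _; case: cayley_action_continuous => _; exact.
by apply: compact_closed => //; exact: metric_hausdorff.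
Qed.

Lemma cayley_cocompact : cocompact_action cayley_action.
Proof.
exists [set y | mdist o y <= 1]; first exact: cayley_proper_metric.
apply/seteqP; split=> // x _; have [g xg] := near_vertex x.
exists g => //; exists (cayley_action g^-1%g x).
  rewrite /= -(cayley_action_isometric g) cayley_action_vertex mulg1.
  case: cayley_group_action => b1 bM.
  by rewrite -bM mulgV b1 metric_sym.
by case: cayley_group_action => b1 bM; rewrite -bM mulgV b1.
Qed.

Lemma cayley_geometric : geometric_setting cayley_action.
Proof.
split.
- exact: cayley_proper_metric.
- by apply: graph_geodesic; exact: cayley_interpolate.
- exact: cayley_action_continuous.
- exact: cayley_action_isometric.
- exact: cayley_proper_action.
- exact: cayley_cocompact.
Qed.

Lemma word_metric_hyperbolic : gromov_hyperbolic (@mdist R X) ->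
  gromov_hyperbolic (word_metric R S).
Proof.
(* Distances differ by at most 1, hence so do Gromov products, and the slack 3 is enough. *)
move=> [D D0 hyp]; exists (D + 3); first lra.
move=> u g h k.
have := hyp (vertex R (u : graph)) (vertex R (g : graph)) (vertex R (h : graph))
  (vertex R (k : graph)).
rewrite /gromov_product !mdist_vertex_cayley !lerBlDr !ge_min.
have [? ?] := word_metric_cayley R HS u g; have [? ?] := word_metric_cayley R HS u h.
have [? ?] := word_metric_cayley R HS u k; have [? ?] := word_metric_cayley R HS g h.
have [? ?] := word_metric_cayley R HS g k; have [? ?] := word_metric_cayley R HS h k.
by move=> /orP[?|?]; apply/orP; [left|right]; lra.
Qed.

End CayleyAction.

(** * Conclusion *)

Section CayleySettingOfAction.
Variables (G : topologicalGroupType) (M : topologicalType) (a : G -> M -> M).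
Hypothesis Ha : sharp_setting a.
Implicit Types g h : G.

(** [K] is the stabilizer of a clopen set [U], open by [translate_near], and [S = K T K] for a
    compact symmetric generating set [T] containing 1. *)
Lemma exists_cayley_setting : exists K S : set G, cayley_setting K S.
Proof.
have [U [cU U0 nU0]] := exists_clopen Ha.
have [S0 cS0 gS0] := compactly_generated Ha.
pose K := [set g | a g @^-1` U = U].
have K1 : K 1%g by apply/seteqP; split=> x; rewrite /= (act1 Ha).
have KM g h : K g -> K h -> K (g * h)%g.
  move=> Kg Kh; apply/seteqP; split=> x; rewrite /= (actM Ha).
    by rewrite -[U (a g _)]/((a g @^-1` U) _) Kg -[U (a h x)]/((a h @^-1` U) x) Kh.
  by rewrite -[U (a g _)]/((a g @^-1` U) _) Kg -[U (a h x)]/((a h @^-1` U) x) Kh.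
have KV g : K g -> K g^-1%g.
  move=> Kg; apply/funext => x /=.
  by have := congr1 (fun A => A (a g^-1%g x)) (Kg : _ = U); rewrite /= (actVK Ha).
have KO : nbhs (1%g : G) K.
  have := translate_near Ha 1%g cU; apply: filterS => g /= gU.
  by rewrite /K /= gU; apply/seteqP; split=> x; rewrite /= (act1 Ha).
(* [K] is closed, and its elements keep two points in [U] and two outside, which [four_points_near]
   with [s0 = 1] confines to a compact set. *)
have cK : compact K.
  have [x Ux _] := clopen_infinite Ha [::] cU U0.
  have [y Uy] := clopen_infinite Ha [:: x] cU U0; rewrite inE => /eqP yx.
  have cnU := clopenC U cU.
  have [z Uz _] := clopen_infinite Ha [::] cnU nU0.
  have [w Uw] := clopen_infinite Ha [:: z] cnU nU0; rewrite inE => /eqP wz.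
  have UV u v : U u -> (~` U) v -> u <> v by move=> Uu Vv uv; apply: Vv; rewrite -uv.
  have [||N nN [L cL NL]] := four_points_near Ha (s0 := 1%g) cU (nesym yx) (nesym wz).
  - by rewrite !(act1 Ha) !inE negb_or; apply/andP; split; apply/eqP; exact: UV.
  - by rewrite !(act1 Ha) !inE negb_or; apply/andP; split; apply/eqP; exact: UV.
  apply: (subclosed_compact _ cL).
    rewrite -openC openE => g /= nKg; rewrite /interior.
    by have := translate_near Ha g cU; apply: filterS => h /= hg Kh;
      apply: nKg; rewrite /K /= -hg.
  move=> g Kg; apply: NL; exists 1%g; first exact: nbhs_singleton.
  rewrite mulg1 -![U (a g _)]/((a g @^-1` U) _) Kg.
  by split.
pose T := [set 1%g] `|` (S0 `|` [set g^-1%g | g in S0]).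
have cT : compact T.
  by apply: compactU; [exact: compact_set1|apply: compactU => //; exact: compact_invg].
have TV g : T g -> T g^-1%g.
  move=> [->|[Sg|[h Sh <-]]]; first by left; rewrite /= invg1.
    by right; right; exists g.
  by right; left; rewrite invgK.
pose S := [set (h * k)%g | h in [set (k * s)%g | k in K & s in T] & k in K].
have SI k s k' : K k -> T s -> K k' -> S (k * s * k')%g.
  by move=> Kk Ts Kk'; exists (k * s)%g; [exists k => //; exists s|exists k'].
have T1 : T 1%g by left.
exists K, S; split=> //.
- by do 2?[apply: compact_mulg => //].
- move=> _ [_ [k Kk [s Ts <-]] [k' Kk' <-]].
  by rewrite !invgM mulgA; apply: SI; [exact: KV|exact: TV|exact: KV].
- by move=> g Kg; have := SI g 1%g 1%g Kg T1 K1; rewrite !mulg1.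
- move=> g _ Kg [_ [k Kk [s Ts <-]] [k' Kk' <-]].
  by rewrite !mulgA; apply: SI => //; exact: KM.
- move=> _ h [_ [k Kk [s Ts <-]] [k' Kk' <-]] Kh.
  by rewrite -mulgA; apply: SI => //; exact: KM.
apply/seteqP; split=> // g _; have : [set: G] g by [].
rewrite -gS0 => -[n _ ng]; exists n => //; apply: word_products_sub ng => s Ss.
by have := SI 1%g s 1%g K1 (or_intror (or_introl Ss)) K1; rewrite mul1g mulg1.
Qed.

End CayleySettingOfAction.

Local Close Scope ring_scope.

Theorem theorem5p7 (R : realType) (G : topologicalGroupType)
    (M : topologicalType) (a : G -> M -> M)
    (G_hausdorff : hausdorff_space G)
    (G_locally_compact : locally_compact [set: G])
    (G_sigma_compact : sigma_compact G)
    (M_hausdorff : hausdorff_space M)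
    (M_compact : compact [set: M])
    (M_infinite : infinite_set [set: M])
    (M_disconnected : ~ connected [set: M])
    (a_continuous : continuous_action a)
    (a_sharply_3_transitive : sharply_3_transitive a) :
  hyperbolic_group R G /\
  equivariantly_homeomorphic_to_group_boundary R a.
Proof.
have Ha : sharp_setting a by split.
(* The Cayley graph serves twice: its hyperbolicity passes to the word metric, and it is a model
   space. *)
have [K [S HS]] := exists_cayley_setting Ha.
have Hb := cayley_geometric R HS.
have [t Dt] := exists_distinct Ha.
have hypX := geometric_hyperbolic (vertex R (1%g : cayley_graph HS)) Hb Ha Dt.
split.
  exists S; split; first exact: cayley_gens_compact HS.
    exact: cayley_generates HS.
  exact: word_metric_hyperbolic hypX.
split.
  exists (graph_point R (cayley_graph HS)), (@cayley_action R G K S HS).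
  case: Hb => pX gX cA iA pA cocA; split=> //.
  by exists (vertex R (1%g : cayley_graph HS)).
move=> X aX [[x _] [pX gX _] cA iA [pA cocA]].
exact: (boundary_homeomorphic x (GeometricSetting pX gX cA iA pA cocA) Ha Dt).
Qed.
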